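(* Let $d\ge1$ be an integer, $\mu>-\frac12$, let $n\ge 0$ be an integer and let $p$ be real with $p>2n+2\mu+d$. Then every $v\in\mathcal V_n(\mathbb V^{d+1},W_{p,0,\mu})$ satisfies the differential equation $$\Big[t(1+t)\partial_t^2+2(1+t)\langle x,\nabla_x\rangle\partial_t+\big(d+2\mu+(-p+2\mu+d+1)t\big)\partial_t+t(1+t)\Delta_x-\big(t^2\Delta_x-\langle x,\nabla_x\rangle^2-(2\mu+d-p)\langle x,\nabla_x\rangle\big)\Big]v=n(n-p+2\mu+d)\,v.$$
   Context: $\Delta_x$ and $\nabla_x$ are the Laplacian and gradient in the variable $x\in\mathbb R^d$; $\langle x,\nabla_x\rangle=\sum_{i=1}^d x_i\partial_{x_i}$ and $\langle x,\nabla_x\rangle^2$ is the composition of this operator with itself. Solid cone: $\mathbb V^{d+1}=\{(x,t):\|x\|\le t,\ x\in\mathbb R^d,\ 0\le t<\infty\}$, with weight $W_{p,0,\mu}(x,t)=(t^2-\|x\|^2)^{\mu-\frac12}(1+t)^{-p}$ and inner product (up to a positive normalizing constant) $\langle f,g\rangle=\int_{\mathbb V^{d+1}}f(x,t)g(x,t)W_{p,0,\mu}(x,t)\,dx\,dt$. $\mathcal V_n(\mathbb V^{d+1},W_{p,0,\mu})$ is the space of polynomials of degree at most $n$ in the $d+1$ variables $(x,t)$ that are orthogonal to all polynomials of degree less than $n$ with respect to this inner product. *)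

(* Defs.v *)
From HB Require Import structures.
From mathcomp Require Import all_boot all_order all_algebra.
(* The notations of mpoly clash with those of MathComp-Analysis and are left
   out: mpoly n R is {mpoly R[n]}, mpolyX R (mnm1 i) is 'X_i, mderiv i p is
   p^`M(i), meval v p is p.@[v]; msize p is 1 + the total degree of p, or 0 if
   p = 0. *)
From mathcomp Require Import -(notations) mpoly.
From mathcomp Require Import all_classical all_reals all_analysis.
Set Implicit Arguments.
Unset Strict Implicit.
Unset Printing Implicit Defensive.
Import Order.TTheory GRing.Theory Num.Theory.
Import numFieldNormedType.Exports.
Local Open Scope classical_set_scope.
Local Open Scope ring_scope.

Section lebesgue_tuple.
Context {R : realType}.
Local Notation mR := (measurableTypeR R).

Definition tcons n (z : (mR * n.-tuple mR)%type) : n.+1.-tuple mR :=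
  [tuple of z.1 :: z.2].

Lemma measurable_tcons n : measurable_fun [set: _] (@tcons n).
Proof. exact: measurable_cons. Qed.

Section lebesgue_tupleS.
Variables (n : nat) (m : {sigma_finite_measure set n.-tuple mR -> \bar R}).

Let mu : {measure set (mR * n.-tuple mR)%type -> \bar R} :=
  product_measure1 (@lebesgue_measure R) m.

Definition lebesgue_cons : set (n.+1.-tuple mR) -> \bar R :=
  pushforward mu (@tcons n).

Let lebesgue_cons0 : lebesgue_cons set0 = 0.
Proof. by rewrite /lebesgue_cons /pushforward preimage_set0 measure0. Qed.

Let lebesgue_cons_ge0 A : (0 <= lebesgue_cons A)%E.
Proof. exact: (measure_ge0 mu). Qed.

Let lebesgue_cons_sigma_additive : semi_sigma_additive lebesgue_cons.
Proof.
exact: (@measure_semi_sigma_additive _ _ _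
  (measure_function_pushforward__canonical__measure_function_Measure
    mu (@measurable_tcons n))).
Qed.

HB.instance Definition _ := isMeasure.Build _ _ _
  lebesgue_cons lebesgue_cons0 lebesgue_cons_ge0 lebesgue_cons_sigma_additive.

Let lebesgue_cons_sigma_finite : sigma_finite [set: _] lebesgue_cons.
Proof.
have /sigma_finiteP[F [TF ndF Foo]] := sigma_finiteT (@lebesgue_measure R).
have /sigma_finiteP[G [TG ndG Goo]] := sigma_finiteT m.
exists (fun k => [set w | F k (tnth w ord0) /\ G k [tuple of behead w]]).
  apply/esym/seteqP; split=> // w _.
  have : (\bigcup_k F k) (tnth w ord0) by rewrite -TF.
  have : (\bigcup_k G k) [tuple of behead w] by rewrite -TG.
  move=> [j _ Gj] [i _ Fi]; exists (maxn i j) => //; split.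
    by move: Fi; exact/subsetPset/ndF/leq_maxl.
  by move: Gj; exact/subsetPset/ndG/leq_maxr.
move=> k; have [mF Fk] := Foo k; have [mG Gk] := Goo k; split.
  apply: measurableI.
    by rewrite -[X in measurable X]setTI; exact: measurable_tnth.
  rewrite -[X in measurable X]setTI.
  exact: (@measurable_behead _ mR n measurableT).
rewrite /lebesgue_cons /pushforward (_ : _ @^-1` _ = F k `*` G k); last first.
  apply/seteqP; split=> -[x w] /=.
    move=> [Fx Gw]; split=> //=.
    rewrite [w](_ : _ = [tuple of behead (tcons (x, w))])//.
    exact/val_inj.
  by move=> [Fx Gw]; split=> //; rewrite [X in G k X](_ : _ = w)//; exact/val_inj.
have -> : mu (F k `*` G k) = (lebesgue_measure (F k) * m (G k))%E.
  exact: product_measure1E.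
by rewrite lte_mul_pinfty// ge0_fin_numE.
Qed.

HB.instance Definition _ := Measure_isSigmaFinite.Build _ _ _
  lebesgue_cons lebesgue_cons_sigma_finite.

End lebesgue_tupleS.

(* Lebesgue measure on R^n, as an iterated product measure *)
Fixpoint lebesgue_tuple n : {sigma_finite_measure set n.-tuple mR -> \bar R} :=
  if n is m.+1 then lebesgue_cons (lebesgue_tuple m)
  else dirac ([tuple] : 0.-tuple mR).

Lemma lebesgue_tupleS n :
  lebesgue_tuple n.+1 =
    pushforward (product_measure1 lebesgue_measure (lebesgue_tuple n))
      (@tcons n) :> (set _ -> \bar R).
Proof. by []. Qed.

Lemma lebesgue_tuple_box n (A : 'I_n -> set mR) :
  (forall i, measurable (A i)) ->
  lebesgue_tuple n [set w | forall i, A i (tnth w i)] =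
    (\prod_(i < n) lebesgue_measure (A i))%E.
Proof.
elim: n A => [|n IH] A mA.
  by rewrite big_ord0/= diracE mem_set//= => -[].
rewrite big_ord_recl -(IH (A \o lift ord0)); last by move=> i; exact: mA.
rewrite lebesgue_tupleS /pushforward.
rewrite (_ : _ @^-1` _ = A ord0 `*`
    [set w | forall i, (A \o lift ord0) i (tnth w i)]); last first.
  apply/seteqP; split=> -[x w] /=.
    move=> Aw; split; first exact: (Aw ord0).
    by move=> i; have := Aw (lift ord0 i); rewrite tnthS.
  move=> [A0 Aw] i; have [->//|] := eqVneq i ord0.
  rewrite eq_sym => /unlift_some[j -> _].
  by rewrite tnthS; exact: Aw.
rewrite product_measure1E//.
rewrite (_ : [set _ | _] =
  \bigcap_(i in [set: 'I_n]) ((@tnth _ _)^~ i @^-1` (A (lift ord0 i)))).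
  apply: fin_bigcap_measurable => // i _.
  by rewrite -[X in measurable X]setTI; exact: measurable_tnth.
by apply/seteqP; split=> w /= Aw => [i _|i]; exact: Aw.
Qed.

End lebesgue_tuple.

Section solid_cone.
Context {R : realType}.
Variable d : nat.
Local Notation point := (d.-tuple (measurableTypeR R) * measurableTypeR R)%type.
Local Notation polyxt := (mpoly d.+1 R).
Implicit Types (z : point) (u v : polyxt).

Definition enorm (x : d.-tuple (measurableTypeR R)) : R :=
  Num.sqrt (\sum_(i < d) tnth x i ^+ 2).

Definition solid_cone : set point :=
  [set z | enorm z.1 <= z.2 /\ 0 <= z.2].

(* the value of powR on the boundary of the cone, a null set, is immaterial *)
Definition cone_weight (p mu : R) z : R :=
  (z.2 ^+ 2 - enorm z.1 ^+ 2) `^ (mu - 2^-1) * (1 + z.2) `^ (- p).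

Definition lebesgue_xt : set point -> \bar R :=
  product_measure1 (lebesgue_tuple d) lebesgue_measure.

(* In mpoly d.+1 R, the last variable stands for t, the d others for x. *)
Definition tvar : polyxt := mpolyX R (mnm1 ord_max).
Definition xvar (i : 'I_d) : polyxt := mpolyX R (mnm1 (lift ord_max i)).
Definition eval_xt v z : R := meval (tnth [tuple of rcons z.1 z.2]) v.

Definition dt v : polyxt := mderiv ord_max v.
Definition dx (i : 'I_d) v : polyxt := mderiv (lift ord_max i) v.
Definition laplacian_x v : polyxt := \sum_(i < d) dx i (dx i v).
Definition euler_x v : polyxt := \sum_(i < d) xvar i * dx i v.

(* For -1/2 < mu, the Lebesgue integral converges absolutely as soon as
   2 mu + d + deg u + deg v < p. *)
Definition cone_ip (p mu : R) u v : R :=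
  \int[lebesgue_xt]_(z in solid_cone)
    (eval_xt u z * eval_xt v z * cone_weight p mu z).

Definition cone_orthopoly (p mu : R) (n : nat) v : Prop :=
  (msize v <= n.+1)%N /\
  forall q : polyxt, (msize q <= n)%N -> cone_ip p mu v q = 0.

Definition cone_operator (p mu : R) v : polyxt :=
  tvar * (1 + tvar) * dt (dt v)
  + 2 * (1 + tvar) * euler_x (dt v)
  + ((d%:R + 2 * mu)%:A + (- p + 2 * mu + d%:R + 1) *: tvar) * dt v
  + tvar * (1 + tvar) * laplacian_x v
  - (tvar ^+ 2 * laplacian_x v - euler_x (euler_x v)
     - (2 * mu + d%:R - p) *: euler_x v).

End solid_cone.

(* Main.v *)
Require Import Defs.
From HB Require Import structures.
From mathcomp Require Import all_boot all_order all_algebra.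
From mathcomp Require Import -(notations) mpoly.
From mathcomp Require Import all_classical all_reals all_analysis measurable_realfun.
From mathcomp Require Import ring lra.
Set Implicit Arguments.
Unset Strict Implicit.
Unset Printing Implicit Defensive.
Import Order.TTheory GRing.Theory Num.Theory.
Import numFieldNormedType.Exports.
Local Open Scope classical_set_scope.
Local Open Scope ring_scope.

(**
The operator is in divergence form for the weight W: with t^2 - |x|^2 and the
boundary of the cone preserved up to scaling by the Euler field E = t d_t + <x, grad>
and by the boosts x_i d_t + t d_i, one has
  L v = W^-1 div (W (1 + t) (d_t v) E) +
        sum_i W^-1 div (W (d_i v) (x_i E + x_i d_t + t d_i)),
so L is symmetric as soon as these divergences have integral 0. On monomials
this is a pair of recurrences between moments. The moment of x^al t^k is the
product of an integral over the unit ball, itself a product of one-dimensional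
integrals of y^j (1 - y^2)^b, and of a beta integral on the half line, and the
recurrences come from integrating by parts in one variable.

Moreover L = E^2 + (2 mu + d - p) E + N where N lowers the degree, and E is
multiplication by the degree on homogeneous polynomials. Hence, for v as in the
theorem, w = L v - n (n - p + 2 mu + d) v has degree less than n, and by
symmetry <w, w> = <v, L w> = 0, which forces w = 0.
*)

(** * Improper integrals of derivatives *)

(** The fields are chosen so that the divergences are polynomial. The Euler field multiplies
    [t^2 - |x|^2] by 2 and the boosts kill it, so the power of it in W only contributes polynomials.
    The t-components of the two kinds of fields are [t (1 + t)] and [x_i (1 + t)], and this factor
    [1 + t] cancels the pole that differentiating [(1 + t)^-p] creates. The obstacle to integrating
    these divergences directly is that W blows up on the boundary of the cone when mu < 1/2. In the
    one-dimensional factors the boundary terms carry the exponent raised by one, which is positive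
    because mu - 1/2 > -1, so they vanish. The condition on p is a budget of degrees: a moment of
    degree m converges once 2 mu + d + m < p, hence up to degree 2 n. A divergence raises the degree
    by one, but it is only applied to a product of one polynomial with a derivative of another,
    which gives that degree back. *)

Section improper_ftc.
Context {R : realType}.
Local Notation leb := (@lebesgue_measure R).
Implicit Types (D : set R) (f F : R -> R).

Lemma is_derive_continuous f (x df : R) :
  is_derive x 1 f df -> {for x, continuous f}.
Proof. by move=> [dfx _]; exact/differentiable_continuous/derivable1_diffP. Qed.

Lemma integral_itv_is_derive f F (a b : R) : a < b ->
  (forall x, a <= x <= b -> is_derive x 1 F (f x)) ->
  (forall x, a <= x <= b -> {for x, continuous f}) ->
  (\int[leb]_(x in `[a, b]) (f x)%:E = (F b - F a)%:E)%E.
Proof.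
move=> ab dF cf; have cF x : a <= x <= b -> {for x, continuous F}.
  by move=> /dF; exact: is_derive_continuous.
have abW x : x \in `]a, b[ -> a <= x <= b.
  by rewrite in_itv/= => /andP[/ltW-> /ltW->].
rewrite EFinB; apply: continuous_FTC2 => //.
- by apply: continuous_in_subspaceT => x; rewrite inE/= in_itv/=; exact: cf.
- split.
  + by move=> x xab; apply: ex_derive; apply: dF; exact: abW.
  + by apply: cvg_at_right_filter; apply: cF; rewrite lexx ltW.
  + by apply: cvg_at_left_filter; apply: cF; rewrite lexx ltW.
- by move=> x xab; rewrite derive1E; apply: derive_val; apply: dF; exact: abW.
Qed.

Lemma measurable_fun_is_derive D f : measurable D ->
  (forall x, D x -> {for x, continuous f}) -> measurable_fun D f.
Proof.
move=> mD cf; apply: (@subspace_continuous_measurable_fun _ D) => //.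
apply: continuous_in_subspaceT => x; by move=> /set_mem Dx; exact: (cf _ Dx).
Qed.

Section exhaustion.
Variables (D : set R) (f F : R -> R) (a_ b_ : R^nat).
Hypothesis mD : measurable D.
Hypothesis ab : forall n, a_ n < b_ n.
Hypothesis abD : forall n, `[a_ n, b_ n] `<=` D.
Hypothesis Dab : forall x, D x -> \forall n \near \oo, x \in `[a_ n, b_ n].
Hypothesis dF : forall x, D x -> is_derive x 1 F (f x).
Hypothesis cf : forall x, D x -> {for x, continuous f}.

Let f_ n := (EFin \o f) \_ `[a_ n, b_ n].

Let mf : measurable_fun D (EFin \o f).
Proof. by apply/measurable_EFinP; exact: (measurable_fun_is_derive mD cf). Qed.

Let mf_ n : measurable_fun D (f_ n).
Proof.
apply/(measurable_restrict (EFin \o f) (measurable_itv _) mD).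
by apply: (measurable_funS mD); [exact: subIsetl|exact: mf].
Qed.

Let f_cvg x : D x -> f_ ^~ x @ \oo --> (f x)%:E.
Proof.
move=> Dx; apply: cvg_near_cst; near=> n.
by rewrite /f_ patchE mem_set//; near: n; exact: Dab.
Unshelve. all: by end_near. Qed.

Let int_f_ n : (\int[leb]_(x in D) f_ n x = (F (b_ n) - F (a_ n))%:E)%E.
Proof.
rewrite -integral_mkcondr (setIidr (@abD n)).
by apply: integral_itv_is_derive => // x xab; [apply: dF|apply: cf];
  apply: (@abD n); rewrite /= in_itv.
Qed.

(** Fatou's lemma on the truncations of [f] to [[a_ n, b_ n]], whose integrals are increments of
    [F]. The intervals are not assumed to be nested. *)
Lemma integrable_exhaustion (K : R) : (forall x, D x -> 0 <= f x) ->
  (forall n, F (b_ n) - F (a_ n) <= K) -> leb.-integrable D (EFin \o f).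
Proof.
move=> f0 FK; apply/integrableP; split; first exact: mf.
have -> : (\int[leb]_(x in D) `|(EFin \o f) x| =
    \int[leb]_(x in D) limn_einf (f_ ^~ x))%E.
  apply: eq_integral => x; rewrite inE => Dx.
  rewrite is_cvg_limn_einfE; last by apply: cvgP; exact: f_cvg.
  by rewrite (cvg_lim _ (f_cvg Dx))//= ger0_norm// f0.
apply: (le_lt_trans (@fatou _ _ _ leb D mD f_ mf_ _)).
  by move=> n x Dx; rewrite /f_ patchE; case: ifPn => // _; rewrite lee_fin f0.
apply: (@le_lt_trans _ _ K%:E); last by rewrite ltry.
rewrite limn_einf_lim; apply: lime_le; first exact: is_cvg_einfs.
apply: nearW => n; apply: (@le_trans _ _ (\int[leb]_(x in D) f_ n x)%E).
  by apply: ereal_inf_lbound; exists n => //=; exact: leqnn.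
by rewrite int_f_ lee_fin.
Qed.

(** Dominated convergence, with [|f|] as the bound. Only limits of [F] along the endpoints enter, so
    [f] may be singular at the ends of [D]. *)
Lemma integral_exhaustion (A B : R) : leb.-integrable D (EFin \o f) ->
  F (a_ n) @[n --> \oo] --> A -> F (b_ n) @[n --> \oo] --> B ->
  \int[leb]_(x in D) f x = B - A.
Proof.
move=> fi FA FB.
have [|||_ _ fcvg] := @dominated_convergence _ _ _ leb D mD f_ (EFin \o f)
  (abse \o (EFin \o f)) mf_ mf.
- by apply: aeW => x; exact: f_cvg.
- exact: integrable_abse.
- apply: aeW => x n Dx; rewrite /f_ patchE; case: ifPn => // _.
  by rewrite abse0 abse_ge0.
have FAB : F (b_ n) - F (a_ n) @[n --> \oo] --> B - A by exact: cvgB.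
rewrite /Rintegral (_ : (\int[leb]_(x in D) (f x)%:E = (B - A)%:E)%E)//.
apply: (cvg_unique _ fcvg) => //=.
under eq_fun do rewrite int_f_.
by apply/fine_cvgP; split; [exact: nearW|exact: FAB].
Qed.
End exhaustion.
End improper_ftc.

(** * One-dimensional integrals *)

Section pospow.
Context {R : realType}.
Local Notation leb := (@lebesgue_measure R).
Implicit Types (a b c r s u y : R) (k : nat).

(* u_+^b, with value 0 at u = 0 for every exponent b *)
Definition pospow b u : R := if 0 < u then u `^ b else 0.

Lemma pospow_gt0 b u : 0 < u -> pospow b u = u `^ b.
Proof. by rewrite /pospow => ->. Qed.

Lemma pospow_le0 b u : u <= 0 -> pospow b u = 0.
Proof. by rewrite /pospow ltNge => ->. Qed.

Lemma pospow_ge0 b u : 0 <= pospow b u.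
Proof. by rewrite /pospow; case: ifPn => // _; exact: powR_ge0. Qed.

Lemma pospowM b s u : 0 < s -> pospow b (s * u) = s `^ b * pospow b u.
Proof.
move=> s0; rewrite /pospow pmulr_rgt0//; case: ifPn => u0; last by rewrite mulr0.
by rewrite powRM// ltW.
Qed.

(** The value 0 for [u <= 0] is what makes this hold for every [b]; with [powR] it fails at [u = 0]
    and [b = -1]. *)
Lemma pospowS b u : pospow (b + 1) u = u * pospow b u.
Proof.
rewrite /pospow; case: ifPn => u0; last by rewrite mulr0.
by rewrite powRD ?(gt_eqF u0) ?implybT// powRr1 ?ltW// mulrC.
Qed.

Lemma measurable_pospow b : measurable_fun [set: R] (pospow b).
Proof.
apply: measurable_fun_ifT => //; first exact: measurable_fun_ltr.
Qed.

Lemma is_derive_powR_comp (g : R -> R) a x dg : 0 < g x ->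
  is_derive x 1 g dg ->
  is_derive x 1 (fun y => g y `^ a) (a * g x `^ (a - 1) * dg).
Proof.
by move=> gx0 gdg; have := is_derive1_comp (is_derive1_powR a gx0) gdg.
Qed.

Lemma is_derive_exprn k y : is_derive y 1 (fun z : R => z ^+ k) (k%:R * y ^+ k.-1).
Proof.
rewrite (_ : (fun z : R => z ^+ k) = (@idfun R) ^+ k); last by rewrite exprfctE.
by apply: is_derive_eq; rewrite /GRing.scale/= mulr1.
Qed.

Lemma powR_cvg0_seq (u_ : R^nat) a : 0 < a -> (forall n, 0 < u_ n) ->
  u_ n @[n --> \oo] --> 0 -> u_ n `^ a @[n --> \oo] --> 0.
Proof.
move=> a0 u0 ucvg.
by have /cvg_at_rightP := powR_cvg0 a0; apply; split.
Qed.

(** In [1 - y^2 = (1 - y) (1 + y)] the factor away from the nearer endpoint lies in [1, 2], so its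
    power is at most [2^|b|]. Unlike the left side, the one-sided powers have explicit
    antiderivatives. *)
Lemma ball_power_le b y : -1 < b -> -1 < y < 1 ->
  (1 - y ^+ 2) `^ b <= 2 `^ `|b| * ((1 - y) `^ b + (1 + y) `^ b).
Proof.
move=> b1 /andP[y1 y2].
have half z : 0 <= z < 1 -> (1 - z ^+ 2) `^ b <= 2 `^ `|b| * (1 - z) `^ b.
  move=> /andP[z0 z1].
  rewrite (_ : 1 - z ^+ 2 = (1 - z) * (1 + z)); last by ring.
  rewrite powRM; [|lra|lra]; rewrite mulrC ler_wpM2r ?powR_ge0//.
  rewrite (@le_trans _ _ ((1 + z) `^ `|b|))//.
    by apply: ler_powR; [lra|exact: ler_norm].
  by apply: ge0_ler_powR; rewrite ?nnegrE//; lra.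
have [y0|/ltW y0] := leP 0 y.
  apply: (le_trans (half y _)); first by rewrite y0.
  by rewrite ler_wpM2l ?powR_ge0// lerDl powR_ge0.
rewrite -[y ^+ 2]sqrrN; apply: (le_trans (half (- y) _)); first by apply/andP; lra.
by rewrite ler_wpM2l ?powR_ge0// opprK lerDr powR_ge0.
Qed.

End pospow.

(** * Integrals of powers against [(1 - y^2)^b] *)

Section one_dim_ball.
Context {R : realType}.
Local Notation leb := (@lebesgue_measure R).
Implicit Types (a b c r s u y : R) (k : nat) (e : bool).

Definition ball_kernel b u y : R := pospow b (u - y ^+ 2).

(* [weight true] gives the absolute moments, used for integrability. *)
Definition weight (e : bool) y : R := if e then `|y| else y.

(** For [b > -1] this is the beta value B((k + 1) / 2, b + 1), except that it vanishes for odd [k]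
    when [e = false]. The proof only uses its recurrences. *)
Definition cball e k b : R :=
  \int[leb]_y (weight e y ^+ k * ball_kernel b 1 y).

Lemma measurable_ball_kernel b u : measurable_fun [set: R] (ball_kernel b u).
Proof.
apply: (measurableT_comp (measurable_pospow b)).
by apply: measurable_funB => //; exact: measurable_funX.
Qed.

Lemma ball_kernelE b y : ball_kernel b 1 y =
  ((fun z => (1 - z ^+ 2) `^ b) \_ (`]-1, 1[ : set R)) y.
Proof.
rewrite patchE /ball_kernel; case: ifPn; rewrite ?notin_setE ?inE/= in_itv/=.
  by move=> /andP[y1 y2]; rewrite pospow_gt0//; nra.
by move=> y1; rewrite pospow_le0// leNgt; apply/negP => y2; apply: y1;
  apply/andP; nra.
Qed.

(** The shift to [n.+2] keeps [[a_ n, b_ n]] nondegenerate at [n = 0]. *)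
Let a_ n : R := - (1 - n.+2%:R^-1).
Let b_ n : R := 1 - n.+2%:R^-1.

Let ab_01 n : 0 < b_ n < 1.
Proof.
rewrite /b_ subr_gt0 invf_lt1// ltr1n/= ltrBlDr ltrDl invr_gt0//.
Qed.

Let ab n : a_ n < b_ n.
Proof. by have := ab_01 n; rewrite /a_ -/(b_ n); lra. Qed.

Let abD n : `[a_ n, b_ n] `<=` `]-1, 1[.
Proof.
move=> y /=; rewrite !in_itv/= /a_ -/(b_ n) => yab.
have := ab_01 n; apply/implyP; lra.
Qed.

Let inv_cvg0 : (n.+2%:R^-1 : R) @[n --> \oo] --> (0 : R).
Proof.
have := @cvg_harmonic R; rewrite -(cvg_shiftS (@harmonic R)); exact.
Qed.

Let Dab y : `]-1, 1[%classic y -> \forall n \near \oo, y \in `[a_ n, b_ n].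
Proof.
rewrite /= in_itv/= => /andP[y1 y2].
have e0 : 0 < 1 - `|y| by rewrite subr_gt0 ltr_norml y1.
near=> n; rewrite in_itv/= /a_ -/(b_ n) -ler_norml /b_ lerBrDr -lerBrDl ltW//.
near: n; have /cvgrPdist_lt/(_ _ e0) := inv_cvg0; apply: filterS => n.
by rewrite sub0r normrN ger0_norm// invr_ge0.
Unshelve. all: by end_near. Qed.

Let ball_cvg0 b : -1 < b ->
  (1 - b_ n ^+ 2) `^ (b + 1) @[n --> \oo] --> 0.
Proof.
move=> b1; apply: powR_cvg0_seq; first lra.
  by move=> n; have := ab_01 n; nra.
have b_1 : b_ n @[n --> \oo] --> (1 : R).
  by rewrite -[X in _ --> X]subr0; apply: cvgB => //; exact: cvg_cst.
rewrite -[X in _ --> X](subrr (1 : R)); apply: cvgB; first exact: cvg_cst.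
by rewrite -[X in _ --> X](expr1n R 2); apply: cvgM.
Qed.

Lemma integrable_ball_kernel b : -1 < b ->
  leb.-integrable [set: R] (EFin \o ball_kernel b 1).
Proof.
move=> b1; have mD : measurable (`]-1, 1[ : set R) by [].
(* Up to a constant, the majorant of [ball_power_le], normalized so as to be the derivative of [G].
   The increments of [G] are at most [2 * 2^(b + 1)] since [1 + b_ n <= 2]. *)
pose g y : R := (b + 1) * ((1 - y) `^ b + (1 + y) `^ b).
have gi : leb.-integrable `]-1, 1[ (EFin \o g).
  pose G y : R := (1 + y) `^ (b + 1) - (1 - y) `^ (b + 1).
  have dG y : `]-1, 1[%classic y -> is_derive y 1 G (g y).
    rewrite /= in_itv/= => /andP[y1 y2].
    have d1 : is_derive y 1 (fun y => (1 + y) `^ (b + 1))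
        ((b + 1) * (1 + y) `^ (b + 1 - 1) * (0 + 1)).
      by apply: is_derive_powR_comp; lra.
    have d2 : is_derive y 1 (fun y => (1 - y) `^ (b + 1))
        ((b + 1) * (1 - y) `^ (b + 1 - 1) * (0 - 1)).
      by apply: is_derive_powR_comp; lra.
    by apply: is_derive_eq; rewrite /g addrK; ring.
  apply: (@integrable_exhaustion _ _ g G a_ b_ mD ab abD Dab dG _ (2 * 2 `^ (b + 1))).
  - move=> y; rewrite /= in_itv/= => /andP[y1 y2].
    have d1 : is_derive y 1 (fun y => (1 - y) `^ b)
        (b * (1 - y) `^ (b - 1) * (0 - 1)) by apply: is_derive_powR_comp; lra.
    have d2 : is_derive y 1 (fun y => (1 + y) `^ b)
        (b * (1 + y) `^ (b - 1) * (0 + 1)) by apply: is_derive_powR_comp; lra.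
    by apply: is_derive_continuous.
  - by move=> y _; apply: mulr_ge0; [lra|rewrite addr_ge0 ?powR_ge0].
  - move=> n; rewrite /G /a_ -/(b_ n) opprK; have := ab_01 n => /andP[b0 b1'].
    have h : (1 + b_ n) `^ (b + 1) <= 2 `^ (b + 1).
      by apply: ge0_ler_powR; rewrite ?nnegrE; lra.
    have := powR_ge0 (1 - b_ n) (b + 1); lra.
have -> : EFin \o ball_kernel b 1 =
    (EFin \o (fun z : R => (1 - z ^+ 2) `^ b)) \_ `]-1, 1[.
  by apply/funext => y; rewrite /= ball_kernelE !patchE; case: ifPn.
apply/(@integrable_mkcond _ _ _ leb _ _ mD).
have Ki : leb.-integrable `]-1, 1[ (EFin \o (fun y => 2 `^ `|b| / (b + 1) * g y)).
  exact: (@integrableZl _ _ _ leb _ mD (2 `^ `|b| / (b + 1)) _ gi).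
apply: (@le_integrable _ _ _ leb _ mD _ _ _ _ Ki).
  apply/measurable_EFinP; apply: (measurable_funS measurableT) => //.
  apply: (measurableT_comp (@measurable_powR R b)).
  by apply: measurable_funB => //; exact: measurable_funX.
move=> y; rewrite /= in_itv/= => y12; rewrite lee_fin ger0_norm ?powR_ge0//.
apply: le_trans (ler_norm _); rewrite /g mulrA divfK; last lra.
exact: ball_power_le.
Qed.

(** [s] times the image of Lebesgue measure under [y |-> s y] has the right value on half-open
    intervals, hence is Lebesgue measure. *)
Lemma ge0_integral_scale (f : R -> \bar R) s : 0 < s ->
  measurable_fun [set: R] f -> (forall y, 0 <= f y)%E ->
  (\int[leb]_y f y = s%:E * \int[leb]_y f (s * y)%R)%E.
Proof.
move=> s0 mf f0.
have ms : measurable_fun [set: measurableTypeR R]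
  (fun y => s * y : measurableTypeR R) by exact: measurable_funM.
pose sleb : {measure set (measurableTypeR R) -> \bar R} :=
  mscale (NngNum (ltW s0))
    (measure_function_pushforward__canonical__measure_function_Measure leb ms).
have lebE A : measurable A -> leb A = sleb A.
  apply: lebesgue_measure_unique => _ [[x y] _ <-].
  rewrite /sleb/= /mscale/= /pushforward.
  have -> : (fun z => s * z) @^-1` `]x, y] = [set` `]s^-1 * x, s^-1 * y]].
    apply/seteqP; split => z /=; rewrite !in_itv/=;
      by rewrite ler_pdivlMl// ltr_pdivrMl.
  rewrite !lebesgue_measure_itv/= !lte_fin ltr_pM2l ?invr_gt0//.
  case: ifPn => _; last by rewrite mule0.
  by rewrite -!EFinB -EFinM -mulrBr mulrA divff ?mul1r// gt_eqF.
rewrite (eq_measure_integral sleb); last by move=> A mA _; exact: lebE.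
rewrite ge0_integral_mscale//; congr (_ * _)%E.
by rewrite ge0_integral_pushforward.
Qed.

Lemma integral_scale (f : R -> \bar R) s : 0 < s ->
  measurable_fun [set: R] f ->
  (\int[leb]_y f y = s%:E * \int[leb]_y f (s * y)%R)%E.
Proof.
move=> s0 mf; rewrite integralE [in RHS]integralE.
rewrite (@ge0_integral_scale (f^\+)%E s)//; last exact: measurable_funepos.
rewrite (@ge0_integral_scale (f^\-)%E s)//; last exact: measurable_funeneg.
have mulB (x y : \bar R) : (s%:E * x - s%:E * y = s%:E * (x - y))%E.
  move: x y => [x| |] [y| |] //=; rewrite ?(gt0_muley, gt0_muleNy)//=.
  by change ((s * x - s * y)%:E = (s * (x - y))%:E); rewrite mulrBr.
by rewrite mulB; congr (_ * (_ - _))%E; apply: eq_integral => x _;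
  rewrite ?funeposE ?funenegE.
Qed.

Lemma measurable_weight e : measurable_fun [set: R] (weight e).
Proof. by case: e; rewrite /weight/=; [exact: normr_measurable|]. Qed.

Lemma weightM e s y : 0 < s -> weight e (s * y) = s * weight e y.
Proof. by move=> s0; case: e; rewrite //= normrM gtr0_norm. Qed.

Lemma normr_weight e y : `|weight e y| = weight true y.
Proof. by case: e; rewrite //= normr_id. Qed.

Lemma measurable_slice e k b u :
  measurable_fun [set: R] (fun y => weight e y ^+ k * ball_kernel b u y).
Proof.
apply: measurable_funM; last exact: measurable_ball_kernel.
by apply: measurable_funX; exact: measurable_weight.
Qed.

Lemma integrable_slice1 e k b : -1 < b ->
  leb.-integrable [set: R] (EFin \o fun y => weight e y ^+ k * ball_kernel b 1 y).
Proof.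
move=> b1; apply: (le_integrable _ _ _ (integrable_ball_kernel b1)) => //.
  by apply/measurable_EFinP; exact: measurable_slice.
move=> y _ /=; rewrite lee_fin normrM normrX normr_weight/=.
rewrite /ball_kernel; have [y1|y1] := leP `|y| 1.
  by rewrite ler_piMl// exprn_ile1.
rewrite pospow_le0 ?normr0 ?mulr0// subr_le0 -real_normK ?num_real//.
by rewrite exprn_ege1// ltW.
Qed.

Lemma ball_kernel_scale b u y : 0 < u ->
  ball_kernel b u (Num.sqrt u * y) = u `^ b * ball_kernel b 1 y.
Proof.
move=> u0; rewrite /ball_kernel -pospowM//; congr pospow.
by rewrite exprMn sqr_sqrtr ?ltW// mulrBr mulr1.
Qed.

Lemma slice_scale e k b u y : 0 < u ->
  weight e (Num.sqrt u * y) ^+ k * ball_kernel b u (Num.sqrt u * y) =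
  u `^ (k%:R / 2 + b) * (weight e y ^+ k * ball_kernel b 1 y).
Proof.
move=> u0; rewrite ball_kernel_scale// weightM ?sqrtr_gt0// exprMn.
have -> : Num.sqrt u ^+ k = u `^ (k%:R / 2).
  by rewrite -powR12_sqrt ?ltW// -powR_mulrn ?powR_ge0// -powRrM mulrC.
by rewrite powRD ?(gt_eqF u0) ?implybT//; ring.
Qed.

Lemma slice_le0 e k b u y : u <= 0 -> weight e y ^+ k * ball_kernel b u y = 0.
Proof.
move=> u0; rewrite /ball_kernel pospow_le0 ?mulr0//.
by rewrite subr_le0 (le_trans u0)// sqr_ge0.
Qed.

Lemma integrable_slice e k b u : -1 < b ->
  leb.-integrable [set: R] (EFin \o fun y => weight e y ^+ k * ball_kernel b u y).
Proof.
move=> b1; have [u0|u0] := leP u 0.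
  apply: (eq_integrable _ (cst 0%E)) => //; last exact: integrable0.
  by move=> y _ /=; rewrite slice_le0.
apply/integrableP; split; first by apply/measurable_EFinP; exact: measurable_slice.
rewrite (@ge0_integral_scale _ (Num.sqrt u)) ?sqrtr_gt0//; last first.
  apply: measurableT_comp => //.
  by apply/measurable_EFinP; exact: measurable_slice.
under eq_integral do rewrite /= slice_scale//.
have /integrableP[_] := @integrableZl _ _ _ leb _ measurableT
  (u `^ (k%:R / 2 + b)) _ (integrable_slice1 e k b1).
by move=> h; rewrite lte_mul_pinfty ?lee_fin ?sqrtr_ge0.
Qed.

(** Substitute [y = sqrt u * z]: the exponent of [u] collects [b] from the kernel, [k / 2] from the
    monomial and [1 / 2] from [dy]. The result is again a [pospow] of [u], which is what permits an
    induction on the dimension of the ball. *)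
Lemma Rintegral_slice e k b u : -1 < b ->
  \int[leb]_y (weight e y ^+ k * ball_kernel b u y) =
  cball e k b * pospow (b + (k%:R + 1) / 2) u.
Proof.
move=> b1; have [u0|u0] := leP u 0.
  rewrite pospow_le0// mulr0 (@eq_Rintegral _ _ _ _ _ (cst 0)); last first.
    by move=> y _; rewrite slice_le0.
  by rewrite /Rintegral integral0.
rewrite /Rintegral (@integral_scale _ (Num.sqrt u)) ?sqrtr_gt0//; last first.
  by apply/measurable_EFinP; exact: measurable_slice.
rewrite fineM//; last first.
  under eq_integral do rewrite /= slice_scale// EFinM.
  apply: integrable_fin_num => //.
  exact: (@integrableZl _ _ _ leb _ measurableT _ _ (integrable_slice1 e k b1)).
rewrite -/(Rintegral _ _ _); under eq_Rintegral do rewrite slice_scale//.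
rewrite RintegralZl//; last exact: integrable_slice1.
rewrite /= -powR12_sqrt ?ltW// -/(cball e k b) pospow_gt0// mulrA.
rewrite -powRD ?(gt_eqF u0) ?implybT// [RHS]mulrC.
by congr (_ `^ _ * _); field.
Qed.

Lemma cballS_shift e k b : -1 < b ->
  cball e k (b + 1) = cball e k b - cball e k.+2 b.
Proof.
move=> b1; rewrite /cball -RintegralB//; [|exact: integrable_slice1..].
apply: eq_Rintegral => y _; rewrite /ball_kernel pospowS.
have -> : weight e y ^+ k.+2 = y ^+ 2 * weight e y ^+ k.
  rewrite 2!exprS mulrA; case: e => //=.
  by rewrite -expr2 real_normK ?num_real.
by ring.
Qed.

Let Rintegral_ball (f : R -> R) :
  (forall y, ~ -1 < y < 1 -> f y = 0) ->
  \int[leb]_y f y = \int[leb]_(y in `]-1, 1[) f y.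
Proof.
move=> f0; rewrite /Rintegral [in RHS]integral_mkcond; congr fine.
apply: eq_integral => y _; rewrite patchE; case: ifPn => //.
by rewrite notin_setE/= in_itv/= => /f0 ->.
Qed.

(** The derivative of [y^k (1 - y^2)^(b + 1)] has integral 0. It mixes the exponents [b + 1] and
    [b]; [cballS_shift] brings both to [b]. *)
Lemma cball_rec k b : -1 < b ->
  (k%:R + 2 * b + 2) * cball false k.+1 b = k%:R * cball false k.-1 b.
Proof.
move=> b1; have mD : measurable (`]-1, 1[ : set R) by [].
pose F y : R := y ^+ k * (1 - y ^+ 2) `^ (b + 1).
pose f y : R := k%:R * (y ^+ k.-1 * (1 - y ^+ 2) `^ (b + 1)) -
  2 * (b + 1) * (y ^+ k.+1 * (1 - y ^+ 2) `^ b).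
pose g y : R := k%:R * (weight false y ^+ k.-1 * ball_kernel (b + 1) 1 y) -
  2 * (b + 1) * (weight false y ^+ k.+1 * ball_kernel b 1 y).
have b2 : -1 < b + 1 by lra.
have int_g : \int[leb]_y g y =
    k%:R * cball false k.-1 (b + 1) - 2 * (b + 1) * cball false k.+1 b.
  rewrite RintegralB// ?RintegralZl//; try exact: integrable_slice1.
    exact: (@integrableZl _ _ _ leb _ measurableT _ _
      (integrable_slice1 false k.-1 b2)).
  exact: (@integrableZl _ _ _ leb _ measurableT _ _
    (integrable_slice1 false k.+1 b1)).
have g0 : \int[leb]_y g y = 0.
  rewrite Rintegral_ball; last first.
    move=> y y1; rewrite /g /ball_kernel !pospow_le0 ?mulr0 ?subr0//;
      rewrite leNgt; apply/negP => y2; apply: y1; apply/andP; nra.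
  have yD y : (y \in `]-1, 1[%classic) -> 0 < 1 - y ^+ 2.
    by rewrite inE/= in_itv/= => /andP[y1 y2]; nra.
  have -> : \int[leb]_(y in `]-1, 1[) g y = \int[leb]_(y in `]-1, 1[) f y.
    by apply: eq_Rintegral => y /yD y1; rewrite /g /f /ball_kernel !pospow_gt0.
  rewrite -(subrr (0 : R)).
  have d1 y a : 0 < 1 - y ^+ 2 -> is_derive y 1 (fun z : R => (1 - z ^+ 2) `^ a)
      (a * (1 - y ^+ 2) `^ (a - 1) * (0 - 2%:R * y ^+ 1)).
    move=> y1; apply: is_derive_powR_comp => //.
    have := is_derive_exprn 2 y; exact: is_deriveB.
  (* Stated through [|z_ n|] so as to serve both endpoints; the limit is 0 because [b + 1 > 0]. *)
  have Fcvg (z_ : R^nat) : (forall n, `|z_ n| = b_ n) -> F (z_ n) @[n --> \oo] --> 0.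
    move=> zE; apply/norm_cvg0P; apply: (@squeeze_cvgr _ _ _ _ (fun=> 0)
      (fun n => (1 - b_ n ^+ 2) `^ (b + 1))).
    - apply: nearW => n; rewrite normr_ge0/= /F normrM.
      rewrite [X in _ * X]ger0_norm ?powR_ge0//.
      rewrite -[z_ n ^+ 2]real_normK ?num_real// zE.
      rewrite ler_piMl ?powR_ge0// normrX zE exprn_ile1//;
        by have := ab_01 n; lra.
    - exact: cvg_cst.
    - exact: ball_cvg0.
  apply: (@integral_exhaustion _ _ f F a_ b_ mD ab abD Dab).
  - move=> y /mem_set/yD y1; have := d1 y (b + 1) y1; have := is_derive_exprn k y.
    move=> dk dP; apply: (is_derive_eq (is_deriveM dk dP)).
    by rewrite /GRing.scale/= /f addrK expr1 [y ^+ k.+1]exprS; ring.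
  - move=> y /mem_set/yD y1; have := d1 y (b + 1) y1; have := d1 y b y1.
    have := is_derive_exprn k.-1 y; have := is_derive_exprn k.+1 y.
    move=> dk dk' dP dP'; apply: is_derive_continuous.
  - apply: (@eq_integrable _ _ _ leb _ mD (EFin \o g)).
      by move=> y /yD y1; rewrite /= /g /f /ball_kernel !pospow_gt0.
    apply: (@integrableS _ _ _ leb setT) => //.
    exact: (@integrableB _ _ _ leb _ measurableT _ _
      (@integrableZl _ _ _ leb _ measurableT k%:R _
        (integrable_slice1 false k.-1 b2))
      (@integrableZl _ _ _ leb _ measurableT (2 * (b + 1)) _
        (integrable_slice1 false k.+1 b1))).
  - by apply: Fcvg => n; rewrite /a_ normrN gtr0_norm//; have /andP[] := ab_01 n.
  - by apply: Fcvg => n; rewrite gtr0_norm//; have /andP[] := ab_01 n.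
have := cballS_shift false k.-1 b1; move: int_g; rewrite g0.
(* At [k = 0] the truncated predecessor makes [h2] speak of [cball] at 0 and 2, but then the term it
   would rewrite has coefficient 0. *)
case: (k) => [|m]/= h1 h2; first by rewrite mul0r in h1 *; lra.
by rewrite h2 in h1; lra.
Qed.

End one_dim_ball.

(** * Beta integrals on the half line *)

Section half_line.
Context {R : realType}.
Local Notation leb := (@lebesgue_measure R).
Implicit Types (p r t : R).

Definition cone_kernel p r t : R := pospow r t * (1 + t) `^ (- p).

(** For [-1 < r] and [r + 1 < p] this is the beta value B(r + 1, p - r - 1). *)
Definition conet p r : R := \int[leb]_t cone_kernel p r t.

Lemma measurable_cone_kernel p r : measurable_fun [set: R] (cone_kernel p r).
Proof.
apply: measurable_funM; first exact: measurable_pospow.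
apply: (measurableT_comp (@measurable_powR R (- p))).
exact: measurable_funD.
Qed.

Let a_ n : R := n.+2%:R^-1.
Let b_ n : R := n.+2%:R.

Let a_gt0 n : 0 < a_ n. Proof. by rewrite invr_gt0. Qed.

Let a_lt1 n : a_ n < 1. Proof. by rewrite invf_lt1// ltr1n. Qed.

Let b_gt1 n : 1 < b_ n. Proof. by rewrite ltr1n. Qed.

Let a_cvg0 : a_ n @[n --> \oo] --> (0 : R).
Proof.
have := @cvg_harmonic R; rewrite -(cvg_shiftS (@harmonic R)); exact.
Qed.

Let near_a t : 0 < t -> \forall n \near \oo, a_ n <= t.
Proof.
move=> t0; have /cvgrPdist_lt/(_ _ t0) := a_cvg0; apply: filterS => n.
by rewrite sub0r normrN ger0_norm ?invr_ge0//; exact: ltW.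
Qed.

Let near_b t : \forall n \near \oo, t <= b_ n.
Proof.
near=> n; apply: (@le_trans _ _ n%:R); last by rewrite ler_nat; exact: leqW.
by near: n; exact: nbhs_infty_ger.
Unshelve. all: by end_near. Qed.

Let is_derive_powR_id r t : 0 < t ->
  is_derive t 1 (fun z : R => z `^ r) (r * t `^ (r - 1)).
Proof. exact: is_derive1_powR. Qed.

Let integrable_near0 r : -1 < r ->
  leb.-integrable [set: R] ((EFin \o (fun t => t `^ r)) \_ `]0, 1]).
Proof.
move=> r1; have mD : measurable (`]0, 1]%classic : set R) by [].
apply/(@integrable_mkcond _ _ _ leb _ _ mD).
have : leb.-integrable `]0, 1] (EFin \o (fun t => (r + 1) * t `^ r)).
  apply: (@integrable_exhaustion _ _ _ (fun t => t `^ (r + 1)) a_ (fun=> 1) mD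
    _ _ _ _ _ 1) => //.
  - move=> n t /=; rewrite !in_itv/= => /andP[ta ->]; rewrite andbT.
    exact: lt_le_trans ta.
  - move=> t /=; rewrite in_itv/= => /andP[/near_a t0 t1]; apply: filterS t0 => n.
    by rewrite in_itv/= t1 andbT.
  - move=> t /=; rewrite in_itv/= => /andP[t0 _].
    by apply: (is_derive_eq (is_derive_powR_id (r + 1) t0)); rewrite addrK.
  - move=> t /=; rewrite in_itv/= => /andP[t0 _].
    by have := is_derive_powR_id r t0 => h; apply: is_derive_continuous.
  - by move=> t _; rewrite mulr_ge0 ?powR_ge0//; lra.
  - by move=> n; rewrite powR1 gerBl powR_ge0.
move=> /(@integrableZl _ _ _ leb _ mD (r + 1)^-1); apply: eq_integrable => //.
by move=> t _ /=; rewrite -EFinM mulKf//; lra.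
Qed.

Let integrable_nearoo q : 1 < q ->
  leb.-integrable [set: R] ((EFin \o (fun t => t `^ (- q))) \_ `[1, +oo[).
Proof.
move=> q1; have mD : measurable (`[1, +oo[%classic : set R) by [].
apply/(@integrable_mkcond _ _ _ leb _ _ mD).
have : leb.-integrable `[1, +oo[ (EFin \o (fun t => (q - 1) * t `^ (- q))).
  apply: (@integrable_exhaustion _ _ _ (fun t => - t `^ (1 - q)) (fun=> 1) b_ mD
    _ _ _ _ _ 1) => //.
  - by move=> n t /=; rewrite !in_itv/= => /andP[->].
  - move=> t /=; rewrite in_itv/= andbT => t1; apply: filterS (near_b t) => n.
    by rewrite in_itv/= t1.
  - move=> t /=; rewrite in_itv/= andbT => t1.
    have t0 : 0 < t by lra.
    have h := is_derive_powR_id (1 - q) t0.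
    by apply: (is_derive_eq (is_deriveN h)); rewrite addrAC subrr add0r; ring.
  - move=> t /=; rewrite in_itv/= andbT => t1.
    have t0 : 0 < t by lra.
    by have := is_derive_powR_id (- q) t0 => h; apply: is_derive_continuous.
  - by move=> t _; rewrite mulr_ge0 ?powR_ge0//; lra.
  - by move=> n; rewrite powR1; have := powR_ge0 (b_ n) (1 - q); lra.
move=> /(@integrableZl _ _ _ leb _ mD (q - 1)^-1); apply: eq_integrable => //.
by move=> t _ /=; rewrite -EFinM mulKf//; lra.
Qed.

Let powR_1D_le1 q t : 0 <= q -> 0 <= t -> (1 + t) `^ (- q) <= 1.
Proof.
by move=> q0 t0; rewrite -[leRHS](powRr0 (1 + t)); apply: ler_powR; lra.
Qed.

Let powR_1D_le q t : 0 <= q -> 0 < t -> (1 + t) `^ (- q) <= t `^ (- q).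
Proof.
move=> q0 t0; rewrite !powRN lef_pV2 ?posrE ?powR_gt0//; last lra.
by apply: ge0_ler_powR => //; rewrite ?nnegrE; lra.
Qed.

(** Dominated by [t^r] on ]0, 1] and by [t^(r - p)] from 1 on. Both comparisons use [p >= 0], which
    follows from the two hypotheses. *)
Lemma integrable_cone_kernel p r : -1 < r -> r + 1 < p ->
  leb.-integrable [set: R] (EFin \o cone_kernel p r).
Proof.
move=> r1 rp; have q1 : 1 < p - r by lra.
have := @integrableD _ _ _ leb _ measurableT _ _
  (integrable_near0 r1) (integrable_nearoo q1).
apply: (@le_integrable _ _ _ leb _ measurableT).
  by apply/measurable_EFinP; exact: measurable_cone_kernel.
move=> t _; rewrite /= !patchE !mem_setE !in_itv/= andbT /cone_kernel.
have [t0|t0] := leP t 0; first by rewrite pospow_le0// mul0r normr0 abse_ge0.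
rewrite pospow_gt0// ger0_norm ?mulr_ge0 ?powR_ge0//.
have [t1|t1] := leP t 1.
  rewrite gee0_abs; last by case: ifPn; rewrite ?adde_ge0 ?lee_fin ?powR_ge0.
  apply: (@le_trans _ _ (t `^ r)%:E).
    by rewrite lee_fin ler_piMr ?powR_ge0// powR_1D_le1//; lra.
  by case: ifPn => _; rewrite ?adde0// leeDl// lee_fin powR_ge0.
rewrite (ltW t1) [X in (X + _)%E](_ : _ = 0%E)// add0e /= lee_fin ger0_norm ?powR_ge0//.
have -> : - (p - r) = r + - p by ring.
by rewrite powRD ?(gt_eqF t0) ?implybT// ler_wpM2l ?powR_ge0// powR_1D_le//; lra.
Qed.

(** The derivative of [t^(r + 1) (1 + t)^(1 - p)] has integral 0; writing [(1 + t)^(1 - p)] as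
    [(1 + t) (1 + t)^-p] gives the two terms. The condition [r + 2 < p] serves both the convergence
    of the second integral and the vanishing of the boundary term at infinity. *)
Lemma conet_rec p r : -1 < r -> r + 2 < p ->
  (r + 1) * conet p r + (r + 2 - p) * conet p (r + 1) = 0.
Proof.
move=> r1 rp; have mD : measurable (`]0, +oo[%classic : set R) by [].
pose F t : R := t `^ (r + 1) * (1 + t) `^ (1 - p).
pose f t : R := (r + 1) * (t `^ r * (1 + t) `^ (1 - p)) +
  (1 - p) * (t `^ (r + 1) * (1 + t) `^ (- p)).
pose g t : R := (r + 1) * cone_kernel p r t + (r + 2 - p) * cone_kernel p (r + 1) t.
have i0 : leb.-integrable [set: R] (EFin \o cone_kernel p r).
  by apply: integrable_cone_kernel; lra.
have i1 : leb.-integrable [set: R] (EFin \o cone_kernel p (r + 1)).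
  by apply: integrable_cone_kernel; lra.
have i0' := @integrableZl _ _ _ leb _ measurableT (r + 1) _ i0.
have i1' := @integrableZl _ _ _ leb _ measurableT (r + 2 - p) _ i1.
have <- : \int[leb]_t g t =
    (r + 1) * conet p r + (r + 2 - p) * conet p (r + 1).
  by rewrite RintegralD// !RintegralZl.
have -> : \int[leb]_t g t = \int[leb]_(t in `]0, +oo[) g t.
  rewrite /Rintegral [in RHS]integral_mkcond; congr fine.
  apply: eq_integral => t _; rewrite patchE mem_setE in_itv/= andbT.
  by case: ltP => // t0; rewrite /g /cone_kernel !pospow_le0// !mul0r !mulr0 addr0.
have gf t : 0 < t -> g t = f t.
  move=> t0; rewrite /g /f /cone_kernel !pospow_gt0//.
  rewrite !powRD ?(gt_eqF t0) ?implybT// ?powRr1 ?ltW//; last first.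
    by apply/implyP => _; lra.
    by lra.
  by ring.
have -> : \int[leb]_(t in `]0, +oo[) g t = \int[leb]_(t in `]0, +oo[) f t.
  by apply: eq_Rintegral => t; rewrite inE/= in_itv/= andbT; exact: gf.
rewrite -[RHS](subrr (0 : R)).
have d1 t q : 0 < t -> is_derive t 1 (fun z : R => (1 + z) `^ q)
    (q * (1 + t) `^ (q - 1) * (0 + 1)).
  by move=> t0; apply: is_derive_powR_comp; lra.
have F_ge0 t : 0 <= F t by rewrite mulr_ge0 ?powR_ge0.
apply: (@integral_exhaustion _ _ f F a_ b_ mD).
- by move=> n; rewrite (lt_trans (a_lt1 n)).
- by move=> n t /=; rewrite !in_itv/= andbT => /andP[ta _]; exact: lt_le_trans ta.
- move=> t /=; rewrite in_itv/= andbT => t0; have na := near_a t0.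
  by have := near_b t; apply: filterS2 na => n; rewrite in_itv/= => -> ->.
- move=> t /=; rewrite in_itv/= andbT => t0.
  apply: (is_derive_eq (is_deriveM (is_derive_powR_id (r + 1) t0) (d1 t (1 - p) t0))).
  by rewrite /GRing.scale/= /f !addrK addrAC subrr add0r; ring.
- move=> t /=; rewrite in_itv/= andbT => t0.
  have h1 := is_derive_powR_id r t0; have h2 := is_derive_powR_id (r + 1) t0.
  have h3 := d1 t (1 - p) t0; have h4 := d1 t (- p) t0.
  by apply: is_derive_continuous.
- apply: (@eq_integrable _ _ _ leb _ mD (EFin \o g)).
    by move=> t; rewrite inE/= in_itv/= andbT => t0; rewrite gf.
  apply: (@integrableS _ _ _ leb setT) => //.
  exact: (@integrableD _ _ _ leb _ measurableT _ _ i0' i1').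
- apply: (@squeeze_cvgr _ _ _ _ (fun=> 0) (fun n => a_ n `^ (r + 1))).
  + apply: nearW => n; rewrite F_ge0/= /F ler_piMr ?powR_ge0//.
    have -> : 1 - p = - (p - 1) by ring.
    by rewrite powR_1D_le1// ?ltW//; lra.
  + exact: cvg_cst.
  + by apply: powR_cvg0_seq => //; lra.
(* At infinity [F t <= t^(r + 2 - p)], written as a positive power of [a_ n], the inverse of [b_ n],
   so that [powR_cvg0_seq] applies at this end too. *)
- apply: (@squeeze_cvgr _ _ _ _ (fun=> 0) (fun n => a_ n `^ (p - r - 2))).
  + apply: nearW => n; rewrite F_ge0/= /F.
    have b0 : 0 < b_ n by have := b_gt1 n; lra.
    apply: (@le_trans _ _ (b_ n `^ (r + 1) * b_ n `^ (- (p - 1)))).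
      have -> : 1 - p = - (p - 1) by ring.
      by rewrite ler_wpM2l ?powR_ge0// powR_1D_le//; lra.
    rewrite -powRD ?(gt_eqF b0) ?implybT// /a_ -/(b_ n).
    have -> // : (b_ n)^-1 `^ (p - r - 2) = b_ n `^ (r + 1 + - (p - 1)).
    by rewrite -powR_inv1 ?ltW// -powRrM; congr (_ `^ _); ring.
  + exact: cvg_cst.
  + by apply: powR_cvg0_seq => //; lra.
Qed.

End half_line.

(** * Moments on the ball and on the cone *)

Section ball_moments.
Context {R : realType}.
Local Notation leb := (@lebesgue_measure R).
Local Notation mR := (measurableTypeR R).
Implicit Types (a b u : R) (e : bool).

(** The squared radius [u] is a parameter, possibly negative, because fixing one coordinate [y]
    replaces it by [u - y^2]. *)
Definition ball_integrand n e (al : 'I_n -> nat) a u (x : n.-tuple mR) : R :=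
  (\prod_(i < n) weight e (tnth x i) ^+ al i) *
  pospow a (u - \sum_(i < n) tnth x i ^+ 2).

Definition osum n (al : 'I_n -> nat) : R := \sum_(i < n) (al i)%:R.

(** Integrating out all coordinates but the first raises the exponent [a] by half of their number
    plus their total degree; the first coordinate then contributes one [cball]. *)
Fixpoint ballc e n (al : 'I_n -> nat) a : R :=
  (if n is m.+1 return ('I_n -> nat) -> R then fun al =>
    ballc e (al \o lift ord0) a *
    cball e (al ord0) (a + (m%:R + osum (al \o lift ord0)) / 2)
  else fun=> 1) al.

Lemma osum_ge0 n (al : 'I_n -> nat) : 0 <= osum al.
Proof. by rewrite sumr_ge0. Qed.

Lemma osumS n (al : 'I_n.+1 -> nat) :
  osum al = (al ord0)%:R + osum (al \o lift ord0).
Proof. by rewrite /osum big_ord_recl. Qed.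

Lemma measurable_ball_integrand n e (al : 'I_n -> nat) a u :
  measurable_fun [set: n.-tuple mR] (ball_integrand e al a u).
Proof.
apply: measurable_funM.
  apply: measurable_prod => i _; apply: measurable_funX.
  apply: (measurableT_comp (measurable_weight e)); exact: measurable_tnth.
apply: (measurableT_comp (measurable_pospow a)); apply: measurable_funB => //.
by apply: measurable_sum => i; apply: measurable_funX; exact: measurable_tnth.
Qed.

Lemma normr_ball_integrand n e (al : 'I_n -> nat) a u x :
  `|ball_integrand e al a u x| = ball_integrand true al a u x.
Proof.
rewrite normrM normr_prod [X in _ * X]ger0_norm ?pospow_ge0//; congr (_ * _).
by apply: eq_bigr => i _; rewrite normrX normr_weight.
Qed.

Lemma ball_integrandS n e (al : 'I_n.+1 -> nat) a u (z : mR * n.-tuple mR) :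
  ball_integrand e al a u (tcons z) = weight e z.1 ^+ al ord0 *
    ball_integrand e (al \o lift ord0) a (u - z.1 ^+ 2) z.2.
Proof.
rewrite /ball_integrand !big_ord_recl /= mulrA; congr (_ * _ * pospow a _).
  by apply: eq_bigr => i _; rewrite tnthS; congr (weight e _ ^+ _).
rewrite opprD addrA; congr (_ - _).
by apply: eq_bigr => i _; rewrite tnthS.
Qed.

Lemma integral_slice e k b u : -1 < b ->
  (\int[leb]_y (weight e y ^+ k * ball_kernel b u y)%:E =
   (cball e k b * pospow (b + (k%:R + 1) / 2) u)%:E)%E.
Proof.
move=> b1; rewrite -Rintegral_slice// fineK//.
by apply: integrable_fin_num => //; exact: integrable_slice.
Qed.

(** Induction on the dimension for all [u] at once: the inner integral is a power of [u - y^2], so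
    the outer one is a slice integral. Integrability comes from Tonelli on the absolute value, which
    is the same computation with [e = true]; hence the quantification over [e]. *)
Lemma ball_moment n e (al : 'I_n -> nat) a u : -1 < a ->
  (lebesgue_tuple n).-integrable setT (EFin \o ball_integrand e al a u) /\
  (\int[lebesgue_tuple n]_x (ball_integrand e al a u x)%:E =
   (ballc e al a * pospow (a + (n%:R + osum al) / 2) u)%:E)%E.
Proof.
move=> a1; elim: n e al u => [|n IH] e al u.
  split.
    apply/integrableP; split.
      by apply/measurable_EFinP; exact: measurable_ball_integrand.
    rewrite integral_dirac//; last first.
      by apply: measurableT_comp => //; apply/measurable_EFinP;
        exact: measurable_ball_integrand.
    by rewrite diracE in_setT mul1e/= ltry.
  rewrite integral_dirac//; last first.
    by apply/measurable_EFinP; exact: measurable_ball_integrand.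
  rewrite diracE in_setT mul1e /ball_integrand !big_ord0 /osum big_ord0 subr0.
  by rewrite !(add0r,mul0r,addr0).
pose al' := al \o lift ord0.
pose b := a + (n%:R + osum al') / 2.
have b1 : -1 < b.
  by rewrite (lt_le_trans a1)// lerDl divr_ge0// addr_ge0// osum_ge0.
pose h e (z : mR * n.-tuple mR) := (weight e z.1 ^+ al ord0 *
  ball_integrand e al' a (u - z.1 ^+ 2) z.2)%:E.
have hE e' : h e' = EFin \o ball_integrand e' al a u \o @tcons R n.
  by apply/funext => z; rewrite /h /= ball_integrandS.
have mh e' : measurable_fun [set: mR * n.-tuple mR] (h e').
  rewrite hE; apply: measurableT_comp; last exact: measurable_tcons.
  by apply/measurable_EFinP; exact: measurable_ball_integrand.
have h_abs e' z : `|h e' z|%E = h true z.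
  by rewrite /h /= normrM normrX normr_weight normr_ball_integrand.
have h_int e' y : (\int[lebesgue_tuple n]_w h e' (y, w) =
    (ballc e' al' a)%:E * (weight e' y ^+ al ord0 * ball_kernel b u y)%:E)%E.
  have [ih1 ih2] := IH e' al' (u - y ^+ 2).
  rewrite /h /=; under eq_integral do rewrite EFinM.
  by rewrite integralZl// ih2 -!EFinM; congr (_%:E); rewrite mulrCA.
have h_int2 e' : (\int[leb]_y \int[lebesgue_tuple n]_w h e' (y, w) =
    (ballc e' al a * pospow (a + (n.+1%:R + osum al) / 2) u)%:E)%E.
  under eq_integral do rewrite h_int.
  rewrite integralZl//; last exact: integrable_slice.
  rewrite integral_slice// -EFinM mulrA -/al' -/b; congr ((_ * pospow _ _)%:E).
  by rewrite /b osumS -natr1 -/al'; field.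
have hi e' : (product_measure1 leb (lebesgue_tuple n)).-integrable setT (h e').
  apply/integrable12ltyP => //.
  under eq_integral do under eq_integral do rewrite h_abs.
  by rewrite h_int2 ltry.
have mt := @measurable_tcons R n.
have mb : measurable_fun [set: n.+1.-tuple mR] (EFin \o ball_integrand e al a u).
  by apply/measurable_EFinP; exact: measurable_ball_integrand.
have hi' : (product_measure1 leb (lebesgue_tuple n)).-integrable
    (@tcons R n @^-1` setT) ((EFin \o ball_integrand e al a u) \o @tcons R n).
  by rewrite preimage_setT -hE.
split.
  exact: (integrable_pushforward mt mb hi' measurableT).
have := integral_pushforward mt mb hi' measurableT.
rewrite preimage_setT => ->; rewrite -hE -integral12_prod_meas1//.
exact: h_int2.
Qed.

Let cball_shift k b : -1 < b ->
  (k%:R + 2 * b + 3) * cball false k (b + 1) = (2 * b + 2) * cball false k b.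
Proof.
move=> b1; rewrite cballS_shift//; have := @cball_rec _ k.+1 b b1.
by rewrite -natr1 /= => h; rewrite mulrBr; lra.
Qed.

Definition oincr n (al : 'I_n -> nat) i := fun j => (al j + (j == i))%N.
Definition odecr n (al : 'I_n -> nat) i := fun j => (al j - (j == i))%N.

Lemma osum_incr n (al : 'I_n -> nat) i : osum (oincr al i) = osum al + 1.
Proof.
rewrite /osum /oincr (eq_bigr (fun j => (al j)%:R + (j == i)%:R)); last first.
  by move=> j _; rewrite natrD.
rewrite big_split/=; congr (_ + _).
by rewrite (bigD1 i)//= eqxx big1 ?addr0// => j /negbTE->.
Qed.

Lemma oincrK n (al : 'I_n -> nat) i : (0 < al i)%N ->
  oincr (odecr al i) i = al.
Proof.
move=> ai; apply/funext => j; rewrite /oincr /odecr.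
by case: eqP => [->|_]; rewrite ?subnK// subn0 addn0.
Qed.

(** Integration by parts in the i-th variable. For the first variable it is [cball_rec]. For another
    one the induction hypothesis acts on the inner factor, and the degree gap of 2 between the two
    sides shifts the exponent of the outer [cball] by 1, which [cball_shift] repairs. *)
Lemma ballc_rec n (be : 'I_n -> nat) i a : -1 < a ->
  (osum be + 2 * a + 1 + n%:R) * ballc false (oincr be i) a =
  (be i)%:R * ballc false (odecr be i) a.
Proof.
move=> a1; elim: n be i => [|n IH] be i; first by case: i.
set be' := be \o lift ord0; have be'0 := osum_ge0 be'.
have n0 : 0 <= n%:R :> R by [].
have [->|] := eqVneq i ord0.
  rewrite /=.
  have -> : oincr be ord0 \o lift ord0 = be'.
    by apply/funext => j; rewrite /oincr /= addn0.
  have -> : odecr be ord0 \o lift ord0 = be'.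
    by apply/funext => j; rewrite /odecr /= subn0.
  rewrite {1}/oincr {1}/odecr eqxx addn1 subn1 osumS -/be' -[n.+1%:R]natr1.
  set b := a + (n%:R + osum be') / 2; have b1 : -1 < b by rewrite /b; lra.
  rewrite mulrCA [RHS]mulrCA -cball_rec//; congr (_ * (_ * _)).
  by rewrite /b; field.
rewrite eq_sym => /unlift_some[j -> _] /=.
have -> : oincr be (lift ord0 j) \o lift ord0 = oincr be' j.
  by apply/funext => k; rewrite /oincr /= (inj_eq (@lift_inj _ _)).
have -> : odecr be (lift ord0 j) \o lift ord0 = odecr be' j.
  by apply/funext => k; rewrite /odecr /= (inj_eq (@lift_inj _ _)).
rewrite {2}/oincr {2}/odecr /= addn0 subn0 osum_incr osumS -/be'.
have n1 : 1 <= n%:R :> R by rewrite ler1n; case: (n) j => [[]|].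
have IHj := IH be' j; rewrite -[be (lift ord0 j)]/(be' j) -[n.+1%:R]natr1.
(* When this exponent is 0, [odecr] does not lower it. The induction hypothesis then says that a
   positive multiple of the left-hand [ballc] is 0. *)
have [bj0|bj0] := posnP (be' j).
  move: IHj; rewrite bj0 !mul0r => /eqP; rewrite mulf_eq0.
  have /gt_eqF -> : 0 < osum be' + 2 * a + 1 + n%:R by lra.
  by move=> /= /eqP ->; rewrite mul0r mulr0.
have be'E : osum be' = osum (odecr be' j) + 1.
  by rewrite -(osum_incr _ j) oincrK.
have od0 := osum_ge0 (odecr be' j).
set b := a + (n%:R + osum (odecr be' j)) / 2.
have b1 : -1 < b by rewrite /b; lra.
have -> : a + (n%:R + (osum be' + 1)) / 2 = b + 1.
  by rewrite be'E /b; field.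
rewrite [RHS]mulrA -IHj.
have sh := cball_shift (be ord0) b1.
have -> : (be ord0)%:R + osum be' + 2 * a + 1 + (n%:R + 1) =
  (be ord0)%:R + 2 * b + 3 by rewrite be'E /b; field.
have -> : osum be' + 2 * a + 1 + n%:R = 2 * b + 2 by rewrite be'E /b; field.
by rewrite mulrCA sh; ring.
Qed.

End ball_moments.

(** * Moments on the cone *)

Section cone_moments.
Context {R : realType}.
Variable d : nat.
Local Notation leb := (@lebesgue_measure R).
Local Notation mR := (measurableTypeR R).
Local Notation point := (d.-tuple mR * mR)%type.
Implicit Types (a p : R) (e : bool) (al : 'I_d -> nat) (k : nat).

(** The cone is encoded in the integrand, which vanishes for [t <= 0] and for [|x| >= |t|], so that
    Fubini applies on the whole space. *)
Definition cone_integrand e al k a p (z : point) : R :=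
  ball_integrand e al a (z.2 ^+ 2) z.1 * cone_kernel p k%:R z.2.

Definition cone_moment al k a p : R :=
  ballc false al a * conet p (2 * a + d%:R + osum al + k%:R).

Lemma cone_kernel_ge0 p r (t : R) : 0 <= cone_kernel p r t.
Proof. by rewrite mulr_ge0 ?pospow_ge0 ?powR_ge0. Qed.

Lemma measurable_cone_integrand e al k a p :
  measurable_fun setT (cone_integrand e al k a p).
Proof.
apply: measurable_funM; last first.
  by apply: measurableT_comp; [exact: measurable_cone_kernel|].
have mx (i : 'I_d) : measurable_fun [set: point] (fun z => tnth z.1 i).
  by apply: (measurableT_comp (@measurable_tnth _ mR d i)).
apply: measurable_funM.
  apply: measurable_prod => i _; apply: measurable_funX.
  exact: (measurableT_comp (measurable_weight e) (mx i)).
apply: (measurableT_comp (measurable_pospow a)); apply: measurable_funB.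
  exact: measurable_funX.
by apply: measurable_sum => i; apply: measurable_funX; exact: mx.
Qed.

(** For fixed [t > 0] the ball of radius [t] contributes [t^(2a + d + |al|)], which leaves a [conet]
    in [t]. That [0 < d] keeps its exponent above -1. *)
Lemma cone_integrand_integral e al k a p : (0 < d)%N -> -1 < a ->
  2 * a + d%:R + osum al + k%:R + 1 < p ->
  (@lebesgue_xt R d).-integrable setT (EFin \o cone_integrand e al k a p) /\
  (\int[@lebesgue_xt R d]_z (cone_integrand e al k a p z)%:E =
   (ballc e al a * conet p (2 * a + d%:R + osum al + k%:R))%:E)%E.
Proof.
move=> d0 a1 hp; set r := 2 * a + d%:R + osum al + k%:R.
have r1 : -1 < r.
  have : 0 <= osum al :> R by exact: osum_ge0.
  have : 0 <= k%:R :> R by [].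
  have : 1 <= d%:R :> R by rewrite ler1n.
  by rewrite /r; lra.
have mE e' : measurable_fun setT (EFin \o cone_integrand e' al k a p).
  by apply/measurable_EFinP; exact: measurable_cone_integrand.
have intx e' t : (\int[lebesgue_tuple d]_x (cone_integrand e' al k a p (x, t))%:E =
    (ballc e' al a)%:E * (cone_kernel p r t)%:E)%E.
  rewrite /cone_integrand /=.
  have [bi bE] := ball_moment e' al (t ^+ 2) a1.
  under eq_integral do rewrite mulrC EFinM.
  rewrite integralZl// bE -!EFinM; congr (_%:E); rewrite mulrCA; congr (_ * _).
  rewrite /cone_kernel mulrAC mulrC; have [t0|t0] := leP t 0.
    by rewrite [pospow r t]pospow_le0// [pospow k%:R t]pospow_le0// !(mul0r,mulr0).
  rewrite !pospow_gt0 ?exprn_gt0// -powR_mulrn ?ltW// -powRrM mulrC.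
  rewrite -powRD ?(gt_eqF t0) ?implybT//; congr (_ `^ _ * _).
  by rewrite /r; field.
have intxt e' : (\int[leb]_t \int[lebesgue_tuple d]_x
    (cone_integrand e' al k a p (x, t))%:E = (ballc e' al a * conet p r)%:E)%E.
  under eq_integral do rewrite intx.
  have ki : leb.-integrable setT (EFin \o cone_kernel p r).
    exact: integrable_cone_kernel.
  rewrite integralZl// EFinM; congr (_ * _)%E.
  by rewrite /conet /Rintegral fineK//; exact: integrable_fin_num.
have ci e' : (@lebesgue_xt R d).-integrable setT (EFin \o cone_integrand e' al k a p).
  apply/integrable21ltyP => //.
  have absE z : `|(EFin \o cone_integrand e' al k a p) z|%E =
      (cone_integrand true al k a p z)%:E.
    by rewrite /= normrM normr_ball_integrand ger0_norm ?cone_kernel_ge0.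
  under eq_integral do under eq_integral do rewrite absE.
  by rewrite intxt ltry.
split => //; rewrite /lebesgue_xt -[LHS]integral21_prod_meas1; first exact: intxt.
exact: ci.
Qed.

(** [conet_rec] times the ball factor. It will say that [divt] of a monomial has integral 0. *)
Lemma cone_moment_rec_t al k a p : (0 < d)%N -> -1 < a ->
  2 * a + d%:R + osum al + k%:R + 2 < p ->
  (osum al + k%:R + 2 * a + 1 + d%:R) * cone_moment al k a p +
  (osum al + k%:R + 2 * a + 2 + d%:R - p) * cone_moment al k.+1 a p = 0.
Proof.
move=> d0 a1 hp; rewrite /cone_moment.
set r := 2 * a + d%:R + osum al + k%:R.
have r1 : -1 < r.
  have : 0 <= osum al :> R by exact: osum_ge0.
  have : 0 <= k%:R :> R by [].
  have : 1 <= d%:R :> R by rewrite ler1n.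
  by rewrite /r; lra.
have rec := conet_rec r1 hp.
have -> : 2 * a + d%:R + osum al + k.+1%:R = r + 1.
  by rewrite /r -[k.+1%:R]natr1; ring.
rewrite -[RHS](mulr0 (ballc false al a)) -rec /r; ring.
Qed.

(** The counterpart for [divx]. The first two moments have the total degree of [al] and [k], hence
    the same [conet] factor; [ballc_rec] merges them into [r + 1] times one ball factor, and
    [conet_rec] concludes. The truncated [odecr] and [k.-1] only occur with coefficient 0. *)
Lemma cone_moment_rec_x al i k a p : (0 < d)%N -> -1 < a ->
  2 * a + d%:R + osum al + k%:R + 2 < p ->
  (al i)%:R * cone_moment (odecr al i) k.+1 a p +
  k%:R * cone_moment (oincr al i) k.-1 a p +
  (osum al + k%:R + 2 * a + 2 + d%:R - p) * cone_moment (oincr al i) k a p = 0.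
Proof.
move=> d0 a1 hp.
have bc := ballc_rec al i a1.
set r := 2 * a + d%:R + osum al + k%:R.
have r1 : -1 < r.
  have : 0 <= osum al :> R by exact: osum_ge0.
  have : 0 <= k%:R :> R by [].
  have : 1 <= d%:R :> R by rewrite ler1n.
  by rewrite /r; lra.
have rec := conet_rec r1 hp.
have decr : (al i)%:R * cone_moment (odecr al i) k.+1 a p =
    (al i)%:R * ballc false (odecr al i) a * conet p r.
  have [->|ai] := posnP (al i); first by rewrite !mul0r.
  rewrite /cone_moment mulrA; congr (_ * conet p _).
  by rewrite /r -(oincrK ai) osum_incr oincrK// -[k.+1%:R]natr1; ring.
have incr : k%:R * cone_moment (oincr al i) k.-1 a p =
    k%:R * ballc false (oincr al i) a * conet p r.
  have [->|k0] := posnP k; first by rewrite !mul0r.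
  rewrite /cone_moment mulrA; congr (_ * conet p _).
  by rewrite osum_incr /r -[in RHS](prednK k0) -[k.-1.+1%:R]natr1; ring.
have -> : cone_moment (oincr al i) k a p =
    ballc false (oincr al i) a * conet p (r + 1).
  by rewrite /cone_moment osum_incr; congr (_ * conet p _); rewrite /r; ring.
rewrite decr incr -bc -[RHS](mulr0 (ballc false (oincr al i) a)) -rec /r; ring.
Qed.

End cone_moments.

(** * The differential operator *)

Section poly_operators.
Context {R : realType}.
Variable d : nat.
Local Notation polyxt := (mpoly d.+1 R).
Implicit Types (u v h q : polyxt) (m : multinom d.+1) (c : R) (i j : 'I_d.+1).

Definition euler v : polyxt := \sum_(i < d.+1) mpolyX R (mnm1 i) * mderiv i v.

Lemma euler_is_linear : linear euler.
Proof.
move=> c u v; rewrite /euler scaler_sumr -big_split/=; apply: eq_bigr => i _.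
by rewrite mderivD mderivZ mulrDr scalerAr.
Qed.
HB.instance Definition _ := GRing.isLinear.Build R polyxt polyxt *:%R euler
  euler_is_linear.

Lemma euler_x_is_linear : linear (@euler_x R d).
Proof.
move=> c u v; rewrite /euler_x scaler_sumr -big_split/=; apply: eq_bigr => i _.
by rewrite /dx mderivD mderivZ mulrDr scalerAr.
Qed.
HB.instance Definition _ := GRing.isLinear.Build R polyxt polyxt *:%R
  (@euler_x R d) euler_x_is_linear.

HB.instance Definition _ := GRing.Linear.copy (@dt R d) (mderiv ord_max).
HB.instance Definition _ (i : 'I_d) :=
  GRing.Linear.copy (@dx R d i) (mderiv (lift ord_max i)).

Lemma eulerE v : euler v = tvar d * dt v + euler_x v.
Proof. by rewrite /euler (bigD1_ord ord_max). Qed.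

Lemma eulerM u v : euler (u * v) = u * euler v + v * euler u.
Proof.
rewrite /euler !mulr_sumr -big_split/=; apply: eq_bigr => i _.
by rewrite mderivM; ring.
Qed.

Lemma mpolyX_mderivX i j m : mpolyX R (mnm1 j) * mderiv i (mpolyX R m) =
  (m i)%:R *: mpolyX R (mnm_add (mnm_sub m (mnm1 i)) (mnm1 j)).
Proof. by rewrite mderivX -scalerAr mulrC -mpolyXD. Qed.

Lemma mnm_sub1K i m : (0 < m i)%N -> mnm_add (mnm_sub m (mnm1 i)) (mnm1 i) = m.
Proof.
move=> mi; apply/mnmP => j; rewrite mnmDE mnmBE mnm1E.
by case: eqP => [<-|_]; rewrite ?subnK// subn0 addn0.
Qed.

Lemma eulerX m : euler (mpolyX R m) = (mdeg m)%:R *: mpolyX R m.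
Proof.
rewrite /euler mdegE natr_sum scaler_suml; apply: eq_bigr => i _.
rewrite mpolyX_mderivX; have [->|mi] := posnP (m i); first by rewrite !scale0r.
by rewrite mnm_sub1K.
Qed.

Lemma mcoeff_euler m v : mcoeff m (euler v) = (mdeg m)%:R * mcoeff m v.
Proof.
have -> : euler v =
    \sum_(k <- msupp v) mcoeff k v *: ((mdeg k)%:R *: mpolyX R k).
  rewrite {1}(mpolyE v) (linear_sum euler); apply: eq_bigr => k _.
  by rewrite linearZ/= eulerX.
have -> : mcoeff m v = \sum_(k <- msupp v) mcoeff k v * (k == m)%:R.
  rewrite {1}(mpolyE v) raddf_sum; apply: eq_bigr => k _ /=.
  by rewrite mcoeffZ mcoeffX.
rewrite raddf_sum mulr_sumr; apply: eq_bigr => k _ /=.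
by rewrite !mcoeffZ mcoeffX; case: eqP => [->|_]; rewrite ?mulr0//; ring.
Qed.

Lemma msize_leP v n :
  reflect (forall m, (n <= mdeg m)%N -> mcoeff m v = 0) (msize v <= n)%N.
Proof.
apply: (iffP idP) => [vn m nm|v0].
  by apply/eqP; rewrite mcoeff_eq0 msize_mdeg_ge// (leq_trans vn).
rewrite msizeE; apply/bigmax_leqP_seq => m mv _.
by rewrite ltnNge; apply: contraL mv => /v0 vm; rewrite -mcoeff_eq0 vm.
Qed.

Lemma msize_mderiv v i n : (msize v <= n.+1)%N -> (msize (mderiv i v) <= n)%N.
Proof.
move=> /msize_leP vn; apply/msize_leP => m nm.
by rewrite mcoeff_mderiv vn ?mul0rn// mdegD mdeg1 addn1.
Qed.

Lemma msizeM_leq u v : (msize (u * v) <= (msize u + msize v).-1)%N.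
Proof.
have [->|u0] := eqVneq u 0; first by rewrite mul0r msize0.
have [->|v0] := eqVneq v 0; first by rewrite mulr0 msize0.
by rewrite msizeM.
Qed.

Lemma msize_mulX v i n : (msize v <= n)%N -> (msize (mpolyX R (mnm1 i) * v) <= n.+1)%N.
Proof.
move=> vn; apply: leq_trans (msizeM_leq _ _) _.
by rewrite msizeX mdeg1/= add1n ltnS.
Qed.

Lemma msize_mulX_mderiv v i j n : (msize v <= n)%N ->
  (msize (mpolyX R (mnm1 i) * mderiv j v) <= n)%N.
Proof.
case: n => [|n vn]; last by apply: msize_mulX; exact: msize_mderiv.
by rewrite leqn0 msize_poly_eq0 => /eqP ->; rewrite linear0 mulr0 msize0.
Qed.

Lemma msizeD_leq u v n : (msize u <= n)%N -> (msize v <= n)%N ->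
  (msize (u + v) <= n)%N.
Proof. by move=> un vn; rewrite (leq_trans (msizeD_le _ _))// geq_max un. Qed.

Lemma msizeZ_leq c v n : (msize v <= n)%N -> (msize (c *: v) <= n)%N.
Proof. by move=> vn; rewrite (leq_trans (msizeZ_le _ _)). Qed.

Lemma msize_sum_leq (I : finType) (F : I -> polyxt) (n : nat) :
  (forall k : I, (msize (F k) <= n)%N) -> (msize (\sum_(k : I) F k) <= n)%N.
Proof.
move=> Fn; apply: (big_ind (fun w : polyxt => (msize w <= n)%N)) => [|u v|k _].
- by rewrite msize0.
- exact: msizeD_leq.
- exact: Fn.
Qed.

Lemma msize_euler v n : (msize v <= n)%N -> (msize (euler v) <= n)%N.
Proof. by move=> vn; apply: msize_sum_leq => i; exact: msize_mulX_mderiv. Qed.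

Lemma msize_euler_x v n : (msize v <= n)%N -> (msize (euler_x v) <= n)%N.
Proof. by move=> vn; apply: msize_sum_leq => i; exact: msize_mulX_mderiv. Qed.

(** The part of the operator that is homogeneous of degree -1. *)
Definition lowering (mu : R) v : polyxt :=
  tvar d * dt (dt v) + 2 *: euler_x (dt v) + (d%:R + 2 * mu) *: dt v +
  tvar d * laplacian_x v.

Lemma msize_lowering mu v n : (msize v <= n.+1)%N -> (msize (lowering mu v) <= n)%N.
Proof.
move=> vn; have dv i : (msize (mderiv i v) <= n)%N by exact: msize_mderiv.
apply: msizeD_leq; last first.
  rewrite /laplacian_x mulr_sumr; apply: msize_sum_leq => i.
  exact: (msize_mulX_mderiv _ _ (dv _)).
apply: msizeD_leq; last exact: (msizeZ_leq _ (dv _)).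
apply: msizeD_leq; first exact: (msize_mulX_mderiv _ _ (dv _)).
exact: (msizeZ_leq _ (msize_euler_x (dv _))).
Qed.

Lemma dtM u v : dt (u * v) = dt u * v + u * dt v.
Proof. exact: mderivM. Qed.

Lemma dxM (i : 'I_d) u v : dx i (u * v) = dx i u * v + u * dx i v.
Proof. exact: mderivM. Qed.

Lemma dtD u v : dt (u + v) = dt u + dt v.
Proof. exact: mderivD. Qed.

Lemma dt_euler_x v : dt (euler_x v) = euler_x (dt v).
Proof.
rewrite /euler_x linear_sum/=; apply: eq_bigr => i _; rewrite /dt /dx mderivM.
rewrite /xvar mderivX mnm1E eq_sym (negbTE (neq_lift _ _)).
by rewrite scale0r mul0r add0r mderiv_comm.
Qed.

Let subm1 i : mnm_sub (mnm1 i) (mnm1 i) = mnm0.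
Proof. by apply/mnmP => j; rewrite mnmBE subnn mnm0E. Qed.

Lemma dt_tvar : dt (tvar d) = 1 :> polyxt.
Proof. by rewrite /dt /tvar mderivX mnm1E eqxx scale1r subm1 mpolyX0. Qed.

Lemma dx_tvar (i : 'I_d) : dx i (tvar d) = 0 :> polyxt.
Proof.
by rewrite /dx /tvar mderivX mnm1E (negbTE (neq_lift _ _)) scale0r.
Qed.

Lemma dx_xvar (i j : 'I_d) : dx i (xvar j) = (i == j)%:R :> polyxt.
Proof.
rewrite /dx /xvar mderivX mnm1E (inj_eq lift_inj) eq_sym.
by case: eqP => [->|_]; rewrite ?scale0r// subm1 mpolyX0 scale1r.
Qed.

Lemma euler_x_tvarM v : euler_x (tvar d * v) = tvar d * euler_x v.
Proof.
rewrite /euler_x mulr_sumr; apply: eq_bigr => i _.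
by rewrite dxM dx_tvar mul0r add0r mulrCA.
Qed.

(** The two terms [t^2] times the Laplacian cancel. Among the rest that preserves degree, the [+ 1]
    in the coefficient of [t d_t] is the first-order term of the square of [t d_t]. *)
Lemma cone_operator_euler p mu v : cone_operator p mu v =
  euler (euler v) + (2 * mu + d%:R - p) *: euler v + lowering mu v.
Proof.
rewrite [euler (euler v)]eulerE !eulerE /lowering /cone_operator.
rewrite dtD dtM dt_tvar dt_euler_x (linearD (@euler_x R d)) /= euler_x_tvarM.
by rewrite -!mul_mpolyC !mpolyCD !mpolyCM !mpolyCN !mpolyC_nat; ring.
Qed.

Lemma msize_cone_operator p mu v n : (msize v <= n)%N ->
  (msize (cone_operator p mu v) <= n)%N.
Proof.
move=> vn; rewrite cone_operator_euler; apply: msizeD_leq.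
  by apply: msizeD_leq; [|apply: msizeZ_leq]; rewrite ?msize_euler.
by apply: msize_lowering; exact: leqW.
Qed.

Lemma msize_cone_operatorB p mu v n : (msize v <= n.+1)%N ->
  (msize (cone_operator p mu v - (n%:R * (n%:R - p + 2 * mu + d%:R)) *: v) <= n)%N.
Proof.
move=> vn; rewrite cone_operator_euler addrAC.
apply: msizeD_leq; last exact: msize_lowering.
apply/msize_leP => m; rewrite leq_eqVlt => /orP[/eqP nm|nm].
  by rewrite mcoeffB mcoeffD !mcoeffZ !mcoeff_euler -nm; ring.
have vm : mcoeff m v = 0 by move/msize_leP : vn; exact.
by rewrite mcoeffB mcoeffD !mcoeffZ !mcoeff_euler vm !mulr0 addr0 subr0.
Qed.

(* [divt h] and [divx i h] are W^-1 div (W h F) for F = (1 + t) E and for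
   F = x_i E + x_i d_t + t d_i respectively, W being the weight. *)
Definition divt (mu p : R) h : polyxt :=
  (1 + tvar d) * euler h + (2 * mu + d%:R) *: ((1 + tvar d) * h) +
  (1 - p) *: (tvar d * h).

Definition divx (mu p : R) (i : 'I_d) h : polyxt :=
  xvar i * dt h + tvar d * dx i h + xvar i * euler h +
  (2 * mu + d%:R + 1 - p) *: (xvar i * h).

(** The left side is the purely second-order part; composing [euler_x] with itself adds a
    first-order term, from differentiating the coefficients. *)
Lemma sum_xvar_euler_x v :
  \sum_(i < d) xvar i * euler_x (dx i v) = euler_x (euler_x v) - euler_x v.
Proof.
apply/eqP; rewrite eq_sym subr_eq; apply/eqP.
rewrite [LHS]/euler_x [euler_x v in RHS]/euler_x -big_split/=.
apply: eq_bigr => i _; rewrite -mulrDr; congr (_ * _).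
rewrite {1}/euler_x linear_sum/= /euler_x.
rewrite [X in _ = _ + X](_ : _ = \sum_(j < d) (i == j)%:R * dx j v); last first.
  rewrite (bigD1 i)//= eqxx mul1r big1 ?addr0// => j /negbTE.
  by rewrite eq_sym => ->; rewrite mul0r.
rewrite -big_split/=; apply: eq_bigr => j _.
rewrite dxM dx_xvar addrC; congr (_ * _ + _).
by rewrite /dx mderiv_comm.
Qed.

Lemma cone_operator_div p mu v : cone_operator p mu v =
  divt mu p (dt v) + \sum_(i < d) divx mu p i (dx i v).
Proof.
have -> : \sum_(i < d) divx mu p i (dx i v) =
    euler_x (dt v) + tvar d * laplacian_x v + tvar d * euler_x (dt v) +
    (euler_x (euler_x v) - euler_x v) + (2 * mu + d%:R + 1 - p) *: euler_x v.
  rewrite -sum_xvar_euler_x /euler_x /laplacian_x !mulr_sumr scaler_sumr.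
  rewrite -!big_split/=; apply: eq_bigr => i _.
  rewrite /divx eulerE -[euler_x (dx i v)]/(\sum_(j < d) xvar j * dx j (dx i v)).
  rewrite (_ : dt (dx i v) = dx i (dt v)); last by rewrite /dt /dx mderiv_comm.
  ring.
rewrite /divt eulerE /cone_operator.
by rewrite -!mul_mpolyC !mpolyCD !mpolyCM !mpolyCN !mpolyC_nat; ring.
Qed.

(** The energy density of the operator: what the product rule leaves over when [q] is moved inside
    the divergences. *)
Definition dirichlet u q : polyxt :=
  (1 + tvar d) * dt u * euler q +
  \sum_(i < d) dx i u * (xvar i * dt q + tvar d * dx i q + xvar i * euler q).

(** The source of self-adjointness. Once [euler] is expanded, the cross terms are [(1 + t) d_t u]
    times [euler_x q] and [(1 + t) d_t q] times [euler_x u]: the boosts supply the 1 and the fields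
    [x_i E] the [t] of the latter. *)
Lemma dirichletC u q : dirichlet u q = dirichlet q u.
Proof.
have dirE f g : dirichlet f g = (1 + tvar d) * dt f * euler g +
    euler_x f * dt g + tvar d * (\sum_(i < d) dx i f * dx i g) +
    euler_x f * euler g.
  rewrite /dirichlet; have -> : \sum_(i < d) dx i f *
      (xvar i * dt g + tvar d * dx i g + xvar i * euler g) =
      euler_x f * dt g + tvar d * (\sum_(i < d) dx i f * dx i g) +
      euler_x f * euler g; last by rewrite !addrA.
    rewrite {1 2}/euler_x !mulr_suml mulr_sumr -!big_split/=.
    by apply: eq_bigr => i _; ring.
rewrite !dirE !eulerE.
have -> : \sum_(i < d) dx i u * dx i q = \sum_(i < d) dx i q * dx i u.
  by apply: eq_bigr => i _; rewrite mulrC.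
ring.
Qed.

Lemma mul_cone_operator p mu u q : q * cone_operator p mu u =
  divt mu p (q * dt u) + \sum_(i < d) divx mu p i (q * dx i u) - dirichlet u q.
Proof.
rewrite cone_operator_div mulrDr mulr_sumr /dirichlet opprD addrACA.
congr (_ + _).
  by rewrite /divt eulerM -!mul_mpolyC; ring.
rewrite -sumrB; apply: eq_bigr => i _.
by rewrite /divx eulerM /dt /dx !mderivM -!mul_mpolyC; ring.
Qed.

Lemma divt_is_linear mu p : linear (divt mu p).
Proof.
move=> c u v; rewrite /divt linearP/= !mulrDr -!scalerAr !scalerDr !scalerA.
by rewrite -!mul_mpolyC; ring.
Qed.

Lemma divx_is_linear mu p (i : 'I_d) : linear (divx mu p i).
Proof.
move=> c u v; rewrite /divx !linearP/= !mulrDr -!scalerAr !scalerDr !scalerA.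
by rewrite -!mul_mpolyC; ring.
Qed.

HB.instance Definition _ mu p := GRing.isLinear.Build R polyxt polyxt *:%R
  (divt mu p) (divt_is_linear mu p).
HB.instance Definition _ mu p (i : 'I_d) := GRing.isLinear.Build R polyxt polyxt *:%R
  (divx mu p i) (divx_is_linear mu p i).

Definition tadd m : multinom d.+1 := mnm_add m (mnm1 ord_max).
Definition xadd (i : 'I_d) m : multinom d.+1 := mnm_add m (mnm1 (lift ord_max i)).
Definition tsub m : multinom d.+1 := mnm_sub m (mnm1 ord_max).
Definition xsub (i : 'I_d) m : multinom d.+1 := mnm_sub m (mnm1 (lift ord_max i)).

Lemma divtX mu p m : divt mu p (mpolyX R m) =
  ((mdeg m)%:R + 2 * mu + d%:R) *: mpolyX R m +
  ((mdeg m)%:R + 2 * mu + d%:R + 1 - p) *: mpolyX R (tadd m).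
Proof.
rewrite /divt eulerX /tadd mpolyXD -/(tvar d).
by rewrite -!mul_mpolyC !mpolyCD !mpolyCM !mpolyCN !mpolyC_nat; ring.
Qed.

Lemma divxX mu p (i : 'I_d) m : divx mu p i (mpolyX R m) =
  (m (lift ord_max i))%:R *: mpolyX R (tadd (xsub i m)) +
  (m ord_max)%:R *: mpolyX R (xadd i (tsub m)) +
  ((mdeg m)%:R + 2 * mu + d%:R + 1 - p) *: mpolyX R (xadd i m).
Proof.
rewrite /divx {1}/xvar {1}/dt mpolyX_mderivX {1}/tvar {1}/dx mpolyX_mderivX eulerX.
have -> : mpolyX R (xadd i m) = xvar i * mpolyX R m.
  by rewrite /xadd mpolyXD mulrC.
rewrite /xadd /tadd /tsub /xsub -!mul_mpolyC !mpolyCD !mpolyCM !mpolyCN !mpolyC_nat.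
ring.
Qed.

End poly_operators.

(** * Symmetry of the operator *)

Section moment_functional.
Context {R : realType}.
Variable d : nat.
Local Notation polyxt := (mpoly d.+1 R).
Implicit Types (u v h q : polyxt) (m : multinom d.+1) (a p mu : R) (k n : nat).

Definition mxexp m : 'I_d -> nat := fun i => m (lift ord_max i).

Definition mmoment a p m : R := cone_moment (mxexp m) (m ord_max) a p.

(** A finite sum over exponents of degree less than [k], hence linear without any integrability
    condition. It is the integral only for [msize v <= k] and in the range of convergence. *)
Definition moment_form k a p v : R :=
  \sum_(m : bmultinom d.+1 k) mcoeff m v * mmoment a p m.

Lemma moment_form_is_linear k a p : scalar (moment_form k a p).
Proof.
move=> c u v; rewrite /moment_form mulr_sumr -big_split/=; apply: eq_bigr => m _.
by rewrite mcoeffD mcoeffZ; ring.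
Qed.
HB.instance Definition _ k a p := GRing.isLinear.Build R polyxt R *%R
  (moment_form k a p) (moment_form_is_linear k a p).

Lemma moment_formX k a p m : (mdeg m < k)%N ->
  moment_form k a p (mpolyX R m) = mmoment a p m.
Proof.
move=> mk; rewrite /moment_form (bigD1 (BMultinom mk))//= mcoeffX eqxx mul1r.
rewrite big1 ?addr0// => m' m'm; rewrite mcoeffX.
have /negbTE -> : m != m' by apply: contra m'm => /eqP mm'; apply/eqP/val_inj.
by rewrite mul0r.
Qed.

Lemma mdeg_xt m : osum (mxexp m) + (m ord_max)%:R = (mdeg m)%:R :> R.
Proof. by rewrite mdegE natr_sum (bigD1_ord ord_max)//= addrC. Qed.

Lemma mxexp_tadd m : mxexp (tadd m) = mxexp m.
Proof.
by apply/funext => i; rewrite /mxexp mnmDE mnm1E (negbTE (neq_lift _ _)) addn0.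
Qed.

Lemma mxexp_tsub m : mxexp (tsub m) = mxexp m.
Proof.
by apply/funext => i; rewrite /mxexp mnmBE mnm1E (negbTE (neq_lift _ _)) subn0.
Qed.

Lemma mxexp_xadd (i : 'I_d) m : mxexp (xadd i m) = oincr (mxexp m) i.
Proof.
apply/funext => j; rewrite /mxexp mnmDE mnm1E /oincr.
by rewrite (inj_eq lift_inj) eq_sym.
Qed.

Lemma mxexp_xsub (i : 'I_d) m : mxexp (xsub i m) = odecr (mxexp m) i.
Proof.
apply/funext => j; rewrite /mxexp mnmBE mnm1E /odecr.
by rewrite (inj_eq lift_inj) eq_sym.
Qed.

Let lift_max_eq (i : 'I_d) : (lift ord_max i == ord_max) = false.
Proof. by rewrite eq_sym (negbTE (neq_lift _ _)). Qed.

Lemma texp_tadd m : (tadd m) ord_max = (m ord_max).+1.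
Proof. by rewrite mnmDE mnm1E eqxx addn1. Qed.

Lemma texp_tsub m : (tsub m) ord_max = (m ord_max).-1.
Proof. by rewrite mnmBE mnm1E eqxx subn1. Qed.

Lemma texp_xadd (i : 'I_d) m : (xadd i m) ord_max = m ord_max.
Proof. by rewrite mnmDE mnm1E lift_max_eq addn0. Qed.

Lemma texp_xsub (i : 'I_d) m : (xsub i m) ord_max = m ord_max.
Proof. by rewrite mnmBE mnm1E lift_max_eq subn0. Qed.

Lemma mdeg_sub_le m m' : (mdeg (mnm_sub m m') <= mdeg m)%N.
Proof. by rewrite !mdegE; apply: leq_sum => i _; rewrite mnmBE leq_subr. Qed.

Section recurrences.
Variables (k n : nat) (a p : R).
Hypotheses (d0 : (0 < d)%N) (a1 : -1 < a) (nk : (n < k)%N).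
Hypothesis hp : 2 * a + d%:R + n%:R + 1 < p.

(** Convergence with one degree to spare, since [divt] and [divx] raise the degree by one. *)
Let deg_conv m : (mdeg m < n)%N ->
  2 * a + d%:R + osum (mxexp m) + (m ord_max)%:R + 2 < p.
Proof.
move=> mn; have := mdeg_xt m; have : (mdeg m)%:R + 1 <= n%:R :> R.
  by rewrite natr1 ler_nat.
by move: hp; lra.
Qed.

Lemma moment_form_divt h : (msize h <= n)%N ->
  moment_form k a p (divt (a + 2^-1) p h) = 0.
Proof.
move=> hn; rewrite (mpolyE h) !linear_sum/= big_seq big1// => m mh.
have mn : (mdeg m < n)%N by rewrite (leq_trans (msize_mdeg_lt mh)).
rewrite !linearZ/= divtX linearD !linearZ/= !moment_formX; last 2 first.
- by rewrite mdegD mdeg1 addn1 (leq_ltn_trans mn).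
- by rewrite (ltn_trans mn).
rewrite /mmoment mxexp_tadd texp_tadd.
have := cone_moment_rec_t d0 a1 (deg_conv mn); rewrite mdeg_xt => rec.
rewrite -[RHS](mulr0 (mcoeff m h)) -rec; congr (_ * _).
by congr (_ * _ + _ * _); field.
Qed.

Lemma moment_form_divx (i : 'I_d) h : (msize h <= n)%N ->
  moment_form k a p (divx (a + 2^-1) p i h) = 0.
Proof.
move=> hn; rewrite (mpolyE h) !linear_sum/= big_seq big1// => m mh.
have mn : (mdeg m < n)%N by rewrite (leq_trans (msize_mdeg_lt mh)).
have addk m' j : (mdeg m' <= mdeg m)%N -> (mdeg (mnm_add m' (mnm1 j)) < k)%N.
  by move=> mm'; rewrite mdegD mdeg1 addn1 (leq_ltn_trans _ nk)// (leq_ltn_trans mm').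
rewrite !linearZ/= divxX !linearD !linearZ/= !moment_formX; last 3 first.
- exact: addk.
- by apply: addk; exact: mdeg_sub_le.
- by apply: addk; exact: mdeg_sub_le.
rewrite /mmoment mxexp_tadd texp_tadd !mxexp_xadd !texp_xadd mxexp_xsub mxexp_tsub.
rewrite texp_xsub texp_tsub.
have := cone_moment_rec_x i d0 a1 (deg_conv mn); rewrite mdeg_xt => rec.
rewrite -[RHS](mulr0 (mcoeff m h)) -rec; congr (_ * _).
by congr (_ + _ + _ * _); field.
Qed.

Lemma moment_form_mul_cone_operator u q :
  (forall i : 'I_d.+1, (msize (q * mderiv i u) <= n)%N) ->
  moment_form k a p (q * cone_operator p (a + 2^-1) u) =
  - moment_form k a p (dirichlet u q).
Proof.
move=> qun; rewrite mul_cone_operator linearB linearD linear_sum/=.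
rewrite moment_form_divt; last exact: qun.
by rewrite big1 ?addr0 ?add0r//= => i _; apply: moment_form_divx; exact: qun.
Qed.

End recurrences.

(** Green's formula: both sides are minus the integral of [dirichlet]. In the size of [q] times a
    derivative of [u], differentiation loses one and the product another, whence [n.+2]. *)
Lemma moment_form_cone_operatorC k n a p u q : (0 < d)%N -> -1 < a -> (n < k)%N ->
  2 * a + d%:R + n%:R + 1 < p ->
  (msize u + msize q <= n.+2)%N ->
  moment_form k a p (q * cone_operator p (a + 2^-1) u) =
  moment_form k a p (u * cone_operator p (a + 2^-1) q).
Proof.
move=> d0 a1 nk hp uqn.
have szM (f g : polyxt) : (msize f + msize g <= n.+2)%N ->
    forall i : 'I_d.+1, (msize (g * mderiv i f) <= n)%N.
  move=> fgn i; case fs : (msize f) fgn => [|s] fgn.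
    move: fs => /eqP; rewrite msize_poly_eq0 => /eqP ->.
    by rewrite linear0 mulr0 msize0.
  apply: leq_trans (msizeM_leq _ _) _.
  apply: (@leq_trans (msize g + s).-1).
    by rewrite -!subn1 leq_sub2r// leq_add2l; apply: msize_mderiv; rewrite fs.
  by rewrite -subn1 leq_subLR add1n -ltnS -addnS addnC.
have qun : (msize q + msize u <= n.+2)%N by rewrite addnC.
have E1 := moment_form_mul_cone_operator d0 a1 nk hp (szM u q uqn).
have E2 := moment_form_mul_cone_operator d0 a1 nk hp (szM q u qun).
by rewrite E1 E2 dirichletC.
Qed.

End moment_functional.

(** * The moment functional as an integral over the cone *)

Section cone_functional.
Context {R : realType}.
Variable d : nat.
Local Notation polyxt := (mpoly d.+1 R).
Local Notation leb := (@lebesgue_measure R).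
Local Notation mR := (measurableTypeR R).
Local Notation point := (d.-tuple mR * mR)%type.
Local Notation mux := (@lebesgue_xt R d).
Implicit Types (u v w q : polyxt) (m : multinom d.+1) (a p mu : R) (k n : nat).
Implicit Types (z : point).

(* the weight extended by 0 outside the open cone *)
Definition kern a p z : R :=
  pospow a (z.2 ^+ 2 - \sum_(i < d) tnth z.1 i ^+ 2) * cone_kernel p 0 z.2.

Lemma kern_ge0 a p z : 0 <= kern a p z.
Proof. by rewrite mulr_ge0 ?pospow_ge0 ?cone_kernel_ge0. Qed.

Lemma kern_gt0 a p z : \sum_(i < d) tnth z.1 i ^+ 2 < z.2 ^+ 2 -> 0 < z.2 ->
  0 < kern a p z.
Proof.
move=> xt t0; rewrite /kern /cone_kernel !pospow_gt0 ?subr_gt0//.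
by rewrite !mulr_gt0// powR_gt0 ?subr_gt0//; move: t0; lra.
Qed.

Lemma eval_xtM u v z : eval_xt (u * v) z = eval_xt u z * eval_xt v z.
Proof. exact: mevalM. Qed.

Lemma tnth_rcons_lift z (i : 'I_d) :
  tnth [tuple of rcons z.1 z.2] (lift ord_max i) = tnth z.1 i.
Proof.
rewrite (tnth_nth 0) lift_max /= nth_rcons size_tuple ltn_ord.
by rewrite -tnth_nth.
Qed.

Lemma tnth_rcons_max z : tnth [tuple of rcons z.1 z.2] ord_max = z.2.
Proof. by rewrite (tnth_nth 0) /= nth_rcons size_tuple ltnn eqxx. Qed.

Lemma eval_xtX m z : eval_xt (mpolyX R m) z =
  (\prod_(i < d) tnth z.1 i ^+ m (lift ord_max i)) * z.2 ^+ m ord_max.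
Proof.
rewrite /eval_xt mevalX (bigD1_ord ord_max)//= mulrC tnth_rcons_max.
by congr (_ * _); apply: eq_bigr => i _; rewrite tnth_rcons_lift.
Qed.

Lemma cone_integrandE m a p z :
  cone_integrand false (mxexp m) (m ord_max) a p z =
  eval_xt (mpolyX R m) z * kern a p z.
Proof.
rewrite eval_xtX /cone_integrand /ball_integrand /kern /mxexp.
rewrite -mulrA -[RHS]mulrA; congr (_ * _); rewrite [RHS]mulrCA; congr (_ * _).
rewrite /cone_kernel mulrA; congr (_ * _); have [t0|t0] := leP z.2 0.
  by rewrite !pospow_le0// mulr0.
by rewrite !pospow_gt0// powRr0 mulr1 powR_mulrn ?ltW.
Qed.

Lemma eval_kernE k v a p z : (msize v <= k)%N -> eval_xt v z * kern a p z =
  \sum_(m : bmultinom d.+1 k)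
    mcoeff m v * cone_integrand false (mxexp m) (bmnm m ord_max) a p z.
Proof.
move=> vk; rewrite {1}(mpolywE vk) /eval_xt raddf_sum/= mulr_suml.
apply: eq_bigr => m _; rewrite mevalZ cone_integrandE /eval_xt; ring.
Qed.

Section convergence.
Variables (k : nat) (a p : R).
Hypotheses (d0 : (0 < d)%N) (a1 : -1 < a) (hp : 2 * a + d%:R + k%:R < p).

Let conv (m : bmultinom d.+1 k) :
  mux.-integrable setT (EFin \o cone_integrand false (mxexp m) (bmnm m ord_max) a p) /\
  (\int[mux]_z (cone_integrand false (mxexp m) (bmnm m ord_max) a p z)%:E =
   (mmoment a p m)%:E)%E.
Proof.
have hm : 2 * a + d%:R + osum (mxexp m) + (bmnm m ord_max)%:R + 1 < p.
  have := mdeg_xt (R := R) m; have : (mdeg m)%:R + 1 <= k%:R :> R.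
    by rewrite natr1 ler_nat; exact: (valP m).
  by move: hp; lra.
exact: (cone_integrand_integral false d0 a1 hm).
Qed.

Lemma integrable_eval_kern v : (msize v <= k)%N ->
  mux.-integrable setT (EFin \o fun z => eval_xt v z * kern a p z).
Proof.
move=> vk; apply: (@eq_integrable _ _ _ mux _ measurableT
  (fun z => \sum_(m : bmultinom d.+1 k) (mcoeff m v *
    cone_integrand false (mxexp m) (bmnm m ord_max) a p z)%:E)%E).
  by move=> z _; rewrite sumEFin -eval_kernE.
apply: integrable_sum => // m _.
exact: (@integrableZl _ _ _ mux _ measurableT (mcoeff m v) _ (conv m).1).
Qed.

Lemma Rintegral_eval_kern v : (msize v <= k)%N ->
  \int[mux]_z (eval_xt v z * kern a p z) = moment_form k a p v.
Proof.
move=> vk; rewrite /moment_form.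
under eq_Rintegral do rewrite (eval_kernE _ _ _ vk).
rewrite /Rintegral.
under eq_integral do rewrite -sumEFin.
rewrite integral_sum//; last first.
  move=> m; exact: (@integrableZl _ _ _ mux _ measurableT (mcoeff m v) _ (conv m).1).
rewrite -[RHS]/(fine (EFin _)) -sumEFin; congr fine; apply: eq_bigr => m _.
under eq_integral do rewrite EFinM.
by rewrite integralZl//; [rewrite (conv m).2|exact: (conv m).1].
Qed.

End convergence.

Let sumsq (x : d.-tuple mR) : R := \sum_(i < d) tnth x i ^+ 2.

Let sumsq_ge0 x : 0 <= sumsq x.
Proof. by apply: sumr_ge0 => i _; exact: sqr_ge0. Qed.

Let enorm_sqr x : enorm x ^+ 2 = sumsq x.
Proof. by rewrite sqr_sqrtr// sumsq_ge0. Qed.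

Let measurable_sumsq : measurable_fun [set: point] (fun z => sumsq z.1).
Proof.
apply: measurable_sum => i; apply: measurable_funX.
by apply: (measurableT_comp (@measurable_tnth _ mR d i)).
Qed.

Lemma measurable_eval_xt v : measurable_fun [set: point] (eval_xt v).
Proof.
have -> : eval_xt v = fun z => \sum_(m <- msupp v) mcoeff m v *
    ((\prod_(i < d) tnth z.1 i ^+ m (lift ord_max i)) * z.2 ^+ m ord_max).
  apply/funext => z; rewrite /eval_xt {1}(mpolyE v) raddf_sum/=.
  by apply: eq_bigr => m _; rewrite mevalZ -/(eval_xt _ _) eval_xtX.
apply: measurable_sum => m; apply: measurable_funM => //.
apply: measurable_funM; last exact: measurable_funX.
apply: measurable_prod => i _; apply: measurable_funX.
by apply: (measurableT_comp (@measurable_tnth _ mR d i)).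
Qed.

Lemma measurable_kern a p : measurable_fun [set: point] (kern a p).
Proof.
apply: measurable_funM; last first.
  by apply: measurableT_comp; [exact: measurable_cone_kernel|].
apply: (measurableT_comp (measurable_pospow a)); apply: measurable_funB => //.
exact: measurable_funX.
Qed.

Let coneE : @solid_cone R d = [set z | sumsq z.1 <= z.2 ^+ 2] `&` [set z | 0 <= z.2].
Proof.
apply/seteqP; split=> z /= [xt t0]; split=> //.
  by rewrite -enorm_sqr lerXn2r// nnegrE sqrtr_ge0.
by rewrite -(@ler_pXn2r _ 2)// ?nnegrE ?sqrtr_ge0// enorm_sqr.
Qed.

Let measurable_le (f g : point -> R) : measurable_fun setT f ->
  measurable_fun setT g -> measurable [set z | f z <= g z].
Proof.
move=> mf mg; have := measurable_fun_ler mf mg.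
by move=> /(_ measurableT [set true]); rewrite setTI; apply.
Qed.

Let measurable_cone : measurable (@solid_cone R d).
Proof.
rewrite coneE; apply: measurableI; apply: measurable_le => //.
exact: measurable_funX.
Qed.

(** The only place where the restricted weight and [kern] may differ: there [powR] is taken at 0,
    where its value for exponent 0 is 1, while [pospow] is 0. *)
Let boundary : set point := [set z | z.2 = enorm z.1].

Let measurable_boundary : measurable boundary.
Proof.
have -> : boundary = @solid_cone R d `&` [set z | z.2 ^+ 2 <= sumsq z.1].
  apply/seteqP; split=> z /=; rewrite /boundary/=.
    move=> zE; split; first by split; rewrite zE ?sqrtr_ge0.
    by rewrite -enorm_sqr zE.
  move=> [[xt t0] tx]; apply/eqP; rewrite eq_le xt andbT.
  by rewrite -(@ler_pXn2r _ 2)// ?nnegrE ?sqrtr_ge0// enorm_sqr.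
by apply: measurableI => //; apply: measurable_le => //; exact: measurable_funX.
Qed.

Let boundary0 : mux boundary = 0.
Proof.
rewrite /lebesgue_xt /product_measure1/=; apply: integral0_eq => x _ /=.
(* The boundary is a graph over [x], so its sections are points. *)
rewrite (_ : xsection boundary x = [set enorm x]) ?lebesgue_measure_set1//.
by apply/seteqP; split=> t; rewrite /xsection /= inE.
Qed.

Lemma cone_ip_moment_form k a p u v : (0 < d)%N -> -1 < a -> 2 * a + d%:R + k%:R < p ->
  (msize (u * v) <= k)%N -> cone_ip p (a + 2^-1) u v = moment_form k a p (u * v).
Proof.
move=> d0 a1 hp uvk; rewrite -Rintegral_eval_kern// /cone_ip /Rintegral; congr fine.
rewrite integral_mkcond; apply: ae_eq_integral => //.
- apply/(measurable_restrictT _ measurable_cone); apply/measurable_EFinP.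
  apply: (measurable_funS measurableT) => //.
  apply: measurable_funM; first by apply: measurable_funM; exact: measurable_eval_xt.
  apply: measurable_funM; last first.
    apply: (measurableT_comp (@measurable_powR R (- p))).
    exact: measurable_funD.
  apply: (measurableT_comp (@measurable_powR R _)).
  rewrite (_ : (fun z : point => _) = (fun z => z.2 ^+ 2 - sumsq z.1)); last first.
    by apply/funext => z; rewrite enorm_sqr.
  by apply: measurable_funB => //; exact: measurable_funX.
- by apply/measurable_EFinP; apply: measurable_funM;
    [exact: measurable_eval_xt|exact: measurable_kern].
exists boundary; split => //= z; apply: contra_notP => zb _.
rewrite patchE eval_xtM.
(* Off the boundary, a point of the cone has [|x| < t] and both weights are the same product of
   powers; outside the cone [kern] vanishes, through one factor or the other according to the sign
   of [t]. *)
have [zc|zc] := boolP (z \in @solid_cone R d).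
  move: zc; rewrite inE /solid_cone/= => -[xt t0].
  have xt' : enorm z.1 < z.2 by rewrite lt_neqAle xt andbT eq_sym; apply/eqP.
  have t0' : 0 < z.2 by rewrite (le_lt_trans (sqrtr_ge0 _) xt').
  congr (_ * _)%:E; rewrite /cone_weight /kern /cone_kernel addrK -/(sumsq _).
  rewrite enorm_sqr !pospow_gt0// ?powRr0 ?mul1r//.
  by rewrite subr_gt0 -enorm_sqr ltr_pXn2r// ?nnegrE ?sqrtr_ge0.
have [t0|t0] := leP z.2 0.
  by rewrite /kern /cone_kernel [pospow 0 _]pospow_le0// mul0r !mulr0.
rewrite /kern [pospow a _]pospow_le0 ?mul0r ?mulr0// subr_le0 leNgt.
apply: contra zc => xt; rewrite inE coneE; split => /=; exact: ltW.
Qed.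

End cone_functional.

(** * Positivity *)

Section nonvanishing.
Context {R : realType}.
Local Notation leb := (@lebesgue_measure R).
Local Notation mR := (measurableTypeR R).

(** The interval contains [size P] distinct points [t_ k], more than [P] has roots. *)
Lemma poly_nonroot (P : {poly R}) (lo hi : R) : P != 0 -> lo < hi ->
  exists2 t, lo < t < hi & P.[t] != 0.
Proof.
move=> P0 lohi; pose t_ k : R := lo + (hi - lo) / k.+2%:R.
have t_itv k : lo < t_ k < hi.
  rewrite /t_ ltrDl divr_gt0 ?subr_gt0//= -ltrBrDl ltr_pdivrMr//.
  by rewrite ltr_pMr ?subr_gt0// ltr1n.
have t_inj : injective t_.
  move=> j k /addrI /(mulfI _) h.
  have /h/invr_inj/eqP : hi - lo != 0 by rewrite gt_eqF// subr_gt0.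
  by rewrite eqr_nat => /eqP[].
have [/allP/= all0|/allPn[t /mapP[k _ ->] Pt]] :=
    boolP (all (root P) (map t_ (iota 0 (size P)))); last by exists (t_ k).
have := max_poly_roots P0 (introT allP all0).
by rewrite map_inj_uniq// iota_uniq size_map size_iota ltnn => /(_ isT).
Qed.

Let mtail n (m : multinom n.+1) : multinom n :=
  Multinom [tuple m (widen_ord (leqnSn n) i) | i < n].

Let mtail_inj n (m m' : multinom n.+1) :
  mtail m = mtail m' -> m ord_max = m' ord_max -> m = m'.
Proof.
move=> tlE maxE; apply/mnmP => i; have [->//|] := eqVneq i ord_max.
rewrite eq_sym => /unlift_some[j -> _].
have := congr1 (fun t : multinom n => t j) tlE.
rewrite !multinomE !tnth_mktuple.
by rewrite (_ : widen_ord _ j = lift ord_max j)//; apply: ord_inj; rewrite lift_max.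
Qed.

(** Each coefficient of [p] can be read off [muni p]: split the exponent into that of the last
    variable and its [mtail]. *)
Lemma muni_neq0 n (p : mpoly n.+1 R) : p != 0 -> muni p != 0.
Proof.
apply: contra => /eqP p0; apply/eqP/mpolyP => m; rewrite mcoeff0.
have : mcoeff (mtail m) ((muni p)`_(m ord_max)) = 0 by rewrite p0 coef0 mcoeff0.
move=> <-; rewrite muniE coef_sum raddf_sum/=.
have termE m' : mcoeff (mtail m) ((mcoeff m' p *: mpolyX R (mtail m') *:
    'X^(m' ord_max))`_(m ord_max)) = mcoeff m' p * (m' == m)%:R.
  rewrite coefZ coefXn; have [<-|m'm] := eqVneq m' m.
    by rewrite eqxx !mulr1 mcoeffZ mcoeffX eqxx mulr1.
  have [maxE|_] := eqVneq (m ord_max) (m' ord_max); last by rewrite !mulr0 mcoeff0.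
  rewrite mulr1 mcoeffZ mcoeffX; case: eqP => [/mtail_inj tlE|//].
  by move: m'm; rewrite tlE ?eqxx.
rewrite (eq_bigr _ (fun m' _ => termE m')).
rewrite [in LHS](mpolyE p) raddf_sum/=; apply: eq_bigr => m' _.
by rewrite mcoeffZ mcoeffX.
Qed.

Lemma horner_muni n (p : mpoly n.+1 R) (x : 'I_n.+1 -> R) :
  (map_poly (meval (x \o lift ord_max)) (muni p)).[x ord_max] = meval x p.
Proof.
rewrite muniE rmorph_sum horner_sum mevalE; apply: eq_bigr => m _ /=.
rewrite map_polyZ/= map_polyXn hornerZ hornerXn mevalZ mevalX -mulrA; congr (_ * _).
rewrite [RHS](bigD1_ord ord_max)//= [RHS]mulrC; congr (_ * _).
apply: eq_bigr => i _; rewrite multinomE tnth_mktuple; congr (_ ^+ m _).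
by apply: ord_inj; rewrite lift_max.
Qed.

(** By induction, the other variables are chosen off the zero set of the leading coefficient in the
    last variable; what remains is a nonzero univariate polynomial. *)
Lemma mpoly_nonroot n (p : mpoly n R) (lo hi : 'I_n -> R) : p != 0 ->
  (forall i, lo i < hi i) ->
  exists2 x : 'I_n -> R, (forall i, lo i < x i < hi i) & meval x p != 0.
Proof.
elim: n p lo hi => [|n IH] p lo hi p0 lohi.
  exists lo => [[]//|]; have pC : p = mpolyC 0 (mcoeff mnm0 p).
    apply: msize1_polyC; rewrite msizeE; apply/bigmax_leqP_seq => m _ _.
    by rewrite mdegE big_ord0.
  by rewrite pC mevalC; apply: contra p0 => /eqP c0; rewrite pC c0 mpolyC0.
have P0 := muni_neq0 p0.
have [|x' x'itv x'c] := IH (lead_coef (muni p)) (lo \o lift ord_max)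
  (hi \o lift ord_max) _ (fun i => lohi _); first by rewrite lead_coef_eq0.
have Q0 : map_poly (meval x') (muni p) != 0.
  apply: contra x'c => /eqP Q0.
  by rewrite lead_coefE -(coef_map (meval x')) Q0 coef0.
have [t tlohi Qt] := poly_nonroot Q0 (lohi ord_max).
pose x i := if unlift ord_max i is Some j then x' j else t.
have xmax : x ord_max = t by rewrite /x unlift_none.
have xlift : x \o lift ord_max = x'.
  by apply/funext => j; rewrite /x /= liftK.
exists x; last by rewrite -horner_muni xlift xmax.
move=> i; have [->|] := eqVneq i ord_max; first by rewrite xmax.
rewrite eq_sym => /unlift_some[j -> _].
have -> : x (lift ord_max j) = x' j by rewrite -xlift.
exact: x'itv.
Qed.

Lemma continuous_meval n (p : mpoly n R) :
  continuous (fun x : 'rV[R]_n => meval (x ord0) p).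
Proof.
have -> : (fun x : 'rV[R]_n => meval (x ord0) p) = fun x : 'rV[R]_n =>
    \sum_(m <- msupp p) mcoeff m p * \prod_i x ord0 i ^+ m i.
  by apply/funext => x; rewrite mevalE.
apply: continuous_big => [|m _]; first exact: add_continuous.
move=> x; apply: (@continuousM _ _ (fun=> mcoeff m p)); first exact: cst_continuous.
apply: (@continuous_big _ _ _ _ _ _ _ _ (fun i (y : 'rV[R]_n) => y ord0 i ^+ m i)).
  exact: mul_continuous.
move=> i _ y; apply: (@continuous_comp _ _ _ (fun M : 'rV[R]_n => M ord0 i)
  (fun t : R => t ^+ m i)); first exact: coord_continuous.
exact: exprn_continuous.
Qed.

Lemma meval_neq0_near n (p : mpoly n R) (x : 'I_n -> R) : meval x p != 0 ->
  exists2 e : R, 0 < e &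
    forall y : 'I_n -> R, (forall i, `|x i - y i| < e) -> meval y p != 0.
Proof.
move=> px; pose X : 'rV[R]_n := \row_i x i.
have XE : meval (X ord0) p = meval x p by apply: meval_eq => i; rewrite mxE.
have : \forall Y \near X, meval ((Y : 'rV[R]_n) ord0) p != 0.
  have h := @continuous_meval n p X; rewrite /continuous_at XE in h.
  by apply: cvgr_neq0 h _.
move=> /nbhs_ballP[e /= e0 eY]; exists e => // y xy.
have <- : meval ((\row_i y i : 'rV[R]_n) ord0) p = meval y p.
  by apply: meval_eq => i; rewrite mxE.
by apply: eY; split=> // i j; rewrite !mxE; exact: xy.
Qed.

End nonvanishing.

(** * Definiteness of the moment form *)

Section positivity.
Context {R : realType}.
Variable d : nat.
Local Notation polyxt := (mpoly d.+1 R).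
Local Notation leb := (@lebesgue_measure R).
Local Notation mR := (measurableTypeR R).
Local Notation point := (d.-tuple mR * mR)%type.
Local Notation mux := (@lebesgue_xt R d).

Lemma lebesgue_xt_box (lo hi : 'I_d.+1 -> R) : (forall i, lo i < hi i) ->
  let B := [set z : point |
    forall i, lo i < tnth [tuple of rcons z.1 z.2] i < hi i] in
  measurable B /\ mux B != 0.
Proof.
move=> lohi B; pose A i : set mR := `]lo i, hi i[%classic.
have mA i : measurable (A i) by exact: measurable_itv.
pose Ax : set (d.-tuple mR) :=
    [set x | forall i : 'I_d, A (lift ord_max i) (tnth x i)].
have mAx : measurable Ax.
  rewrite (_ : Ax = \bigcap_(i in [set: 'I_d])
      ((@tnth _ _)^~ i @^-1` A (lift ord_max i))).
    apply: fin_bigcap_measurable => // i _.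
    by rewrite -[X in measurable X]setTI; exact: measurable_tnth.
  by apply/seteqP; split=> w /= Aw => [i _|i]; exact: Aw.
have -> : B = Ax `*` A ord_max.
  apply/seteqP; split=> -[x t] /= Bz.
    split=> [i|]; rewrite /A /= in_itv/=.
      by have := Bz (lift ord_max i); rewrite (tnth_rcons_lift (x, t)).
    by have := Bz ord_max; rewrite (tnth_rcons_max (x, t)).
  move: Bz => [Axx At] i; have [->|] := eqVneq i ord_max.
    by rewrite (tnth_rcons_max (x, t)); move: At; rewrite /A /= in_itv.
  rewrite eq_sym => /unlift_some[j -> _]; rewrite (tnth_rcons_lift (x, t)).
  by have := Axx j; rewrite /A /= in_itv.
split; first exact: measurableX.
rewrite /lebesgue_xt product_measure1E//.
have lebA i : leb (A i) = (hi i - lo i)%:E.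
  by rewrite lebesgue_measure_itv/= lte_fin lohi -EFinB.
rewrite [X in (X * _)%E]
  (_ : _ = (\prod_(i < d) leb (A (lift ord_max i)))%E); last first.
  exact: (lebesgue_tuple_box (fun i : 'I_d => mA (lift ord_max i))).
rewrite [X in (_ * X)%E](_ : _ = (hi ord_max - lo ord_max)%:E); last exact: lebA.
rewrite (eq_bigr _ (fun i _ => lebA (lift ord_max i))) prodEFin -EFinM eqe.
rewrite mulf_neq0//; last by rewrite subr_eq0 gt_eqF.
by apply/prodf_neq0 => i _; rewrite subr_eq0 gt_eqF.
Qed.

(** A nonnegative integrand with integral 0 vanishes almost everywhere, whereas a nonzero [w] would
    make this one positive on a small box inside the open cone. *)
Lemma moment_form_definite k (a p : R) (w : polyxt) :
  (0 < d)%N -> -1 < a -> 2 * a + d%:R + k%:R < p ->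
  (msize (w * w) <= k)%N -> moment_form k a p (w * w) = 0 -> w = 0.
Proof.
move=> d0 a1 hp wwk form0; apply/eqP; apply: contraPT isT => w0 _.
have dn0 : 0 < d%:R :> R by rewrite ltr0n.
(* This box, with [1 < t < 2] and [0 < x_i < 1/d], lies in the open cone: [x_i^2 <= x_i <= 1/d]
   gives [|x|^2 <= 1 < t^2]. *)
pose lo (i : 'I_d.+1) : R := if i == ord_max then 1 else 0.
pose hi (i : 'I_d.+1) : R := if i == ord_max then 2 else d%:R^-1.
have lohi i : lo i < hi i.
  by rewrite /lo /hi; case: eqP => _; rewrite ?invr_gt0//; lra.
have [x xlohi wx] := mpoly_nonroot w0 lohi.
have [e e0 we] := meval_neq0_near wx.
pose lo' i := Num.max (lo i) (x i - e); pose hi' i := Num.min (hi i) (x i + e).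
have lohi' i : lo' i < hi' i.
  have /andP[l1 l2] := xlohi i.
  by rewrite /lo' /hi' gt_max !lt_min lohi; apply/andP; split; apply/andP; lra.
have [] := lebesgue_xt_box lohi'; set B := [set z : point | _] => mB.
pose f z : R := eval_xt (w * w) z * kern a p z.
have fi : mux.-integrable setT (EFin \o f) by exact: integrable_eval_kern hp _ wwk.
have f_ge0 z : 0 <= f z by rewrite /f eval_xtM -expr2 mulr_ge0 ?sqr_ge0 ?kern_ge0.
have f_gt0 z : B z -> f z != 0.
  rewrite /B/= => Bz; have zB i : [/\ lo i < tnth [tuple of rcons z.1 z.2] i < hi i
      & `|x i - tnth [tuple of rcons z.1 z.2] i| < e].
    have := Bz i; rewrite /lo' /hi' gt_max lt_min => /andP[/andP[l1 l2] /andP[h1 h2]].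
    by split; [rewrite l1|rewrite ltr_norml; apply/andP; lra].
  have ez : eval_xt w z != 0 by apply: we => i; have [] := zB i.
  have [/andP[t1 t2] _] := zB ord_max; move: t1 t2.
  rewrite tnth_rcons_max /lo /hi eqxx => t1 t2.
  have k0 : 0 < kern a p z.
    apply: kern_gt0; last lra.
    apply: (@le_lt_trans _ _ 1); last by rewrite expr_gt1// ltW//; lra.
    rewrite (_ : 1 = \sum_(i < d) d%:R^-1 :> R); last first.
      by rewrite sumr_const card_ord -[RHS]mulr_natl divff// gt_eqF.
    apply: ler_sum => i _; have [/andP[x1 x2] _] := zB (lift ord_max i); move: x1 x2.
    rewrite tnth_rcons_lift /lo /hi eq_sym (negbTE (neq_lift _ _)) => x1 x2.
    apply: le_trans (ltW x2); rewrite expr2 ger_pMr//.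
    by rewrite (le_trans (ltW x2))// invf_le1// ler1n.
  rewrite /f eval_xtM; apply: mulf_neq0; first exact: mulf_neq0.
  by rewrite gt_eqF.
have int_f : (\int[mux]_z `|(EFin \o f) z| = 0)%E.
  rewrite (_ : (fun z => `|_|%E) = EFin \o f); last first.
    by apply/funext => z; rewrite /= ger0_norm.
  rewrite -(fineK (integrable_fin_num measurableT fi)) -[fine _]/(Rintegral _ _ _).
  by rewrite (Rintegral_eval_kern d0 a1 hp wwk) form0.
have mf : measurable_fun setT (EFin \o f) by case/integrableP : fi.
have [N [mN N0 BN]] := (ae_eq_integral_abs mux measurableT mf).1 int_f.
have BsubN : B `<=` N.
  by move=> z Bz; apply: BN => /= /(_ I) [] /eqP; apply/negP; exact: f_gt0.
move=> /negP; apply; rewrite eq_le measure_ge0 andbT -N0.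
by rewrite le_measure// inE.
Qed.

End positivity.

Theorem theorem3p2 (R : realType) (d : nat) (mu : R) (n : nat) (p : R)
    (hd : (1 <= d)%N) (hmu : - 2^-1 < mu)
    (hp : 2 * n%:R + 2 * mu + d%:R < p)
    (v : mpoly d.+1 R) (hv : cone_orthopoly p mu n v) :
  cone_operator p mu v = (n%:R * (n%:R - p + 2 * mu + d%:R)) *: v.
Proof.
have [vn vorth] := hv; set l := n%:R * _.
pose w := cone_operator p mu v - l *: v.
have wn : (msize w <= n)%N by exact: msize_cone_operatorB.
pose a := mu - 2^-1; have muE : mu = a + 2^-1 by rewrite /a subrK.
have a1 : -1 < a by rewrite /a; lra.
(* As a bound on sizes this allows degree 2 n; with [a = mu - 1/2], the condition [kp] is then
   exactly [hp]. *)
pose k := n.*2.+1.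
have kp : 2 * a + d%:R + k%:R < p.
  have -> : k%:R = 2 * n%:R + 1 :> R.
    by rewrite /k -muln2 -[_.+1%:R]natr1 natrM mulrC.
  by rewrite /a; lra.
have szM (u q : mpoly d.+1 R) : (msize u <= n.+1)%N -> (msize q <= n)%N ->
    (msize (u * q) <= k)%N.
  move=> un qn; apply: leq_trans (msizeM_leq _ _) _.
  apply: leq_trans (leq_pred _) _; rewrite /k -addnn -addSn; exact: leq_add.
have vq0 (q : mpoly d.+1 R) : (msize q <= n)%N -> moment_form k a p (v * q) = 0.
  move=> qn; rewrite -(cone_ip_moment_form hd a1 kp (szM _ _ vn qn)) -muE.
  exact: vorth.
suff w0 : w = 0 by apply/eqP; rewrite -subr_eq0 -/w w0.
apply: (moment_form_definite hd a1 kp); first by apply: szM => //; exact: leqW.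
(* Both terms integrate to 0 by orthogonality of [v]: the second since [w] has degree less than [n],
   the first after moving the operator to [w], whose degree it does not raise. *)
have -> : w * w = w * cone_operator p mu v - l *: (v * w).
  by rewrite {2}/w -!mul_mpolyC; ring.
rewrite linearB linearZ/= vq0// mulr0 subr0 muE.
rewrite (@moment_form_cone_operatorC _ _ k n.*2 a p v w)//.
- by rewrite vq0// -muE; exact: msize_cone_operator.
- by move: hp; rewrite /a -muln2 natrM; lra.
- by rewrite -addnn -2!addSn addSnnS leq_add// ltnW.
Qed.
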